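(* Fix $p=7/10$. For $2\leq N\leq 11$ define $q_N$ by $$q_2=2,\quad q_3=\tfrac52,\quad q_4=3,\quad q_5=4,\quad q_6=5,\quad q_7=7,\quad q_8=10,\quad q_9=12,\quad q_{10}=15,\quad q_{11}=20.$$ Then for every $N=2,\dots,11$, $$D_j(\beta_{7/10,\,q_N})>0\ \text{ for all } 0\le j\le N-1,\qquad\text{and}\qquad D_N(\beta_{7/10,\,q_N})<0.$$ Consequently, for every $N=2,\dots,11$, there is a nonempty open set $U_N\subset(0,\infty)^2$ such that, for every $(p,q)\in U_N$, the $(N+1)\times(N+1)$ leading Hankel test excludes $\beta_{p,q}$, while none of the preceding leading Hankel tests (those of sizes $(j+1)\times(j+1)$ with $0\le j\le N-1$) excludes $\beta_{p,q}$. These open sets can be chosen such that, in addition, every $(p,q)\in U_N$ satisfies $p\notin I$, $q\notin I$, and $(p,q)\notin(0,1]\times(0,1]$.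
   Context: For $p,q>0$, $\beta_{p,q}$ denotes the beta distribution on $[0,1]$ with density $x^{p-1}(1-x)^{q-1}/B(p,q)$ on $(0,1)$, where $B$ is the Euler beta function. Its moments are $m_n=(p)_n/(p+q)_n$, with $(a)_n=a(a+1)\cdots(a+n-1)$. For a probability measure $\mu$ on $\mathbb{R}$ with finite moments $m_n(\mu)=\int x^n\,\mu(\mathrm{d}x)$, the free cumulants $\kappa_n(\mu)$, $n\ge 1$, are determined by $m_n(\mu)=\sum_{\pi\in NC(n)}\prod_{V\in\pi}\kappa_{|V|}(\mu)$ for all $n\geq 1$, where $NC(n)$ is the set of noncrossing partitions of $\{1,\dots,n\}$ and the product is over the blocks $V$ of $\pi$. For $N\ge0$, $H_N(\mu)=[\kappa_{i+j+2}(\mu)]_{i,j=0}^{N}$, an $(N+1)\times(N+1)$ matrix, and $D_N(\mu)=\det H_N(\mu)$. The $(N+1)\times(N+1)$ leading Hankel test is the condition that $H_N(\mu)$ be positive semidefinite (a necessary condition for free infinite divisibility of a compactly supported $\mu$); the test excludes $\mu$ if $H_N(\mu)$ is not positive semidefinite. The set $I\subset\mathbb{R}$ is $$I=\bigcup_{n\geq1}\left(\frac{2n-1}{2n},\frac{2n}{2n+1}\right)\cup\bigcup_{n\geq1}\left(\frac{2n+2}{2n+1},\frac{2n+1}{2n}\right).$$ *)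

(* Defs.v *)
From HB Require Import structures.
From mathcomp Require Import all_boot all_order all_algebra.
From mathcomp Require Import all_classical all_reals all_analysis.
From mathcomp Require Import measurable_realfun.

Set Implicit Arguments.
Unset Strict Implicit.
Unset Printing Implicit Defensive.

Import Order.TTheory GRing.Theory Num.Theory.
Import numFieldNormedType.Exports.

Section noncrossing_partitions.
Variable n : nat.

Definition noncrossing (P : {set {set 'I_n}}) : bool :=
  [forall V in P, forall W in P,
   forall a in V, forall b in W, forall c in V, forall d in W,
     [&& a < b, b < c & c < d]%N ==> (V == W)].

Definition NC : {set {set {set 'I_n}}} :=
  [set P | finset.partition P [set: 'I_n]%SET & noncrossing P].

Lemma NC_top : (0 < n)%N -> [set [set: 'I_n]]%SET \in NC.
Proof.
move=> n_gt0; rewrite finset.inE; apply/andP; split.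
  apply/and3P; split.
  - by rewrite finset.cover1.
  - by apply/finset.trivIsetP => A B; rewrite !finset.in_set1 => /eqP-> /eqP->; rewrite eqxx.
  - rewrite finset.in_set1 eq_sym; apply/finset.set0Pn; exists (Ordinal n_gt0).
    by rewrite finset.in_setT.
apply/forall_inP => V; rewrite finset.in_set1 => /eqP ->.
apply/forall_inP => W; rewrite finset.in_set1 => /eqP ->.
do 4![apply/forall_inP => ? _].
by rewrite eqxx implybT.
Qed.

Lemma NC_card_lt (P : {set {set 'I_n}}) (V : {set 'I_n}) :
  P \in NC -> P != [set [set: 'I_n]]%SET -> V \in P -> (#|V| < n)%N.
Proof.
rewrite finset.inE => /andP[/and3P[_ /finset.trivIsetP tP P0] _] PT VP.
have := max_card (mem V); rewrite card_ord leq_eqVlt => /orP[/eqP cV|//].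
have VT : V = [set: 'I_n]%SET.
  by apply/eqP; rewrite finset.eqEcard finset.subsetT /= finset.cardsT card_ord cV.
case/negP: PT; apply/eqP/finset.setP => W; rewrite finset.in_set1; apply/idP/eqP => [WP|->].
  apply/eqP; apply: contraNT P0 => WT.
  have := tP _ _ WP VP; rewrite VT => /(_ WT).
  by rewrite -finset.setI_eq0 finset.setIT => /eqP <-.
by rewrite -VT.
Qed.

End noncrossing_partitions.

Local Open Scope classical_set_scope.
Local Open Scope ring_scope.

(* The library's [beta_fun], [beta_pdf], [beta_prob] only take natural
   parameters; the definitions below take real ones. *)
Section beta_distribution.
Context {R : realType}.
Implicit Types p q x : R.

Definition euler_beta p q : R :=
  \int[lebesgue_measure]_(x in `]0, 1[) (x `^ (p - 1) * (1 - x) `^ (q - 1)).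

Definition betar_pdf p q : R -> R :=
  (fun x => x `^ (p - 1) * (1 - x) `^ (q - 1) / euler_beta p q) \_ `]0, 1[.

Lemma euler_beta_ge0 p q : 0 <= euler_beta p q.
Proof. by apply: Rintegral_ge0 => x _; rewrite mulr_ge0 ?powR_ge0. Qed.

Lemma betar_pdf_ge0 p q x : 0 <= betar_pdf p q x.
Proof.
by apply: restrict_ge0 => {}x _; rewrite !mulr_ge0 ?powR_ge0 ?invr_ge0 ?euler_beta_ge0.
Qed.

Lemma measurable_betar_pdf p q : measurable_fun [set: R] (betar_pdf p q).
Proof.
apply/measurable_restrict => //; apply: measurable_funTS.
apply: measurable_funM => //; apply: measurable_funM.
  exact: measurable_powR.
apply: (@measurableT_comp _ _ _ _ _ _ (@powR R ^~ (q - 1))).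
  exact: measurable_powR.
exact: measurable_funB.
Qed.

Definition betar p q : set R -> \bar R :=
  fun A => (\int[lebesgue_measure]_(x in A) (betar_pdf p q x)%:E)%E.

Section betar_measure.
Variables p q : R.

Let betar0 : betar p q set0 = 0%E.
Proof. by rewrite /betar integral_set0. Qed.

Let betar_ge0 A : (0 <= betar p q A)%E.
Proof. by apply: integral_ge0 => x _; rewrite lee_fin betar_pdf_ge0. Qed.

Let betar_sigma_additive : semi_sigma_additive (betar p q).
Proof.
move=> /= F mF tF mUF; rewrite /betar; apply: cvg_toP.
  apply: ereal_nondecreasing_is_cvgn => m n mn.
  apply: lee_sum_nneg_natr => // k _ _; apply: integral_ge0 => /= x Fkx.
  by rewrite lee_fin betar_pdf_ge0.
rewrite ge0_integral_bigcup//=.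
- apply/measurable_funTS/measurableT_comp => //.
  exact: measurable_betar_pdf.
- by move=> x _; rewrite lee_fin betar_pdf_ge0.
Qed.

HB.instance Definition _ := isMeasure.Build _ _ _
  (betar p q) betar0 betar_ge0 betar_sigma_additive.

End betar_measure.

End beta_distribution.

Section free_cumulants.
Context {R : realType}.

Definition moment_cumulant (m kappa : nat -> R) : Prop :=
  forall n, (1 <= n)%N ->
    m n = \sum_(P in NC n) \prod_(V in P) kappa #|V|.

Lemma moment_cumulantE (kappa : nat -> R) n : (0 < n)%N ->
  \sum_(P in NC n) \prod_(V in P) kappa #|V| =
  kappa n + \sum_(P in NC n | P != [set [set: 'I_n]]%SET)
              \prod_(V in P) kappa #|V|.
Proof.
by move=> n_gt0; rewrite (bigD1 _ (NC_top n_gt0)) /= big_set1 finset.cardsT card_ord.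
Qed.

Lemma moment_cumulant_uniq (m k1 k2 : nat -> R) :
  moment_cumulant m k1 -> moment_cumulant m k2 ->
  forall n, (1 <= n)%N -> k1 n = k2 n.
Proof.
move=> h1 h2; elim/ltn_ind => n IH n_gt0.
have := h1 n n_gt0; rewrite (h2 n n_gt0) (moment_cumulantE k1) ?(moment_cumulantE k2)//.
rewrite [X in _ + X = _](_ : _ = \sum_(P in NC n | P != [set [set: 'I_n]]%SET)
              \prod_(V in P) k1 #|V|); first by move=> /addIr.
apply: eq_bigr => P /andP[PNC PT]; apply: eq_bigr => V VP.
rewrite IH ?(NC_card_lt PNC PT VP)// card_gt0.
move: PNC; rewrite finset.inE => /andP[/and3P[_ _ P0] _].
by apply: contraNneq P0 => <-.
Qed.

Lemma moment_cumulant_ex (m : nat -> R) : exists kappa, moment_cumulant m kappa.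
Proof.
pose step (s : seq R) : R := let n := size s in
  m n - \sum_(P in NC n | P != [set [set: 'I_n]]%SET)
          \prod_(V in P) s`_#|V|.
pose S := fix S n := if n is n'.+1 then rcons (S n') (step (S n')) else [::].
have sizeS n : size (S n) = n by elim: n => //= n IH; rewrite size_rcons IH.
have nthS n i : (i < n)%N -> (S n)`_i = step (S i).
  elim: n => // n IH; rewrite ltnS leq_eqVlt /= nth_rcons sizeS => /orP[/eqP->|lt_in].
    by rewrite ltnn eqxx.
  by rewrite lt_in IH.
pose kappa n := step (S n).
exists kappa => n n_gt0; rewrite (moment_cumulantE kappa)//.
rewrite {1}/kappa {1}/step sizeS [X in _ = _ - X + _](_ : _ =
   \sum_(P in NC n | P != [set [set: 'I_n]]%SET) \prod_(V in P) kappa #|V|).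
  by rewrite subrK.
apply: eq_bigr => P /andP[PNC PT]; apply: eq_bigr => V VP.
by rewrite nthS// (NC_card_lt PNC PT VP).
Qed.

Definition moment (mu : {measure set R -> \bar R}) (n : nat) : R :=
  \int[mu]_x (x ^+ n).

(* The index 0 carries no information: only [free_cumulant mu n] with
   [1 <= n] is determined by the moment-cumulant formula. *)
Definition free_cumulant (mu : {measure set R -> \bar R}) : nat -> R :=
  xget (fun=> 0) [set kappa | moment_cumulant (moment mu) kappa].

Lemma free_cumulantP (mu : {measure set R -> \bar R}) :
  moment_cumulant (moment mu) (free_cumulant mu).
Proof.
have [kappa hk] := moment_cumulant_ex (moment mu).
exact: (xgetPex _ (ex_intro _ kappa hk)).
Qed.

Lemma free_cumulant_eq (mu : {measure set R -> \bar R}) (kappa : nat -> R) :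
  moment_cumulant (moment mu) kappa ->
  forall n, (1 <= n)%N -> free_cumulant mu n = kappa n.
Proof. by move=> hk; apply: moment_cumulant_uniq hk; exact: free_cumulantP. Qed.

End free_cumulants.

Section hankel.
Context {R : realType}.
Implicit Types mu : {measure set R -> \bar R}.

Definition hankel mu (N : nat) : 'M[R]_N.+1 :=
  \matrix_(i < N.+1, j < N.+1) free_cumulant mu (i + j + 2).

Definition hankel_det mu (N : nat) : R := \det (hankel mu N).

Definition possemidef n (A : 'M[R]_n) : Prop :=
  A^T = A /\ forall v : 'rV[R]_n, 0 <= (v *m A *m v^T) 0 0.

Definition hankel_test mu (N : nat) : Prop := possemidef (hankel mu N).

End hankel.

Definition Iset {R : realType} : set R :=
  (\bigcup_(n in [set n : nat | (1 <= n)%N])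
    `](2 * n%:R - 1) / (2 * n%:R), (2 * n%:R) / (2 * n%:R + 1)[%classic) `|`
  (\bigcup_(n in [set n : nat | (1 <= n)%N])
    `](2 * n%:R + 2) / (2 * n%:R + 1), (2 * n%:R + 1) / (2 * n%:R)[%classic).

(* [qval N] is meaningful for [2 <= N <= 11] only. *)
Definition qval {R : realType} (N : nat) : R :=
  [:: 2; 5 / 2; 3; 4; 5; 7; 10; 12; 15; 20]`_(N - 2).

(* Main.v *)
(* Removing from a noncrossing partition the first point x of its ground set,
   and cutting the rest at the second element of the block of x, shows
   that the array g(k, s) of the sums over NC(k), in which the block V of the
   first point is weighted by kappa_{|V| + s}, satisfies g(0, s) = kappa_s,
   g(k + 1, s) = sum_j m_j g(k - j, s + 1) and g(k, 0) = m_k.  It can be solved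
   for the kappa_s by subtractions, given the moments; those of the beta
   distribution satisfy m_{n+1} = (p + n) / (p + q + n) m_n, by integrating the
   derivative of x^p (1 - x)^q.

   The determinants D_0, ..., D_N are the products of the pivots of Gaussian
   elimination on the Hankel matrix; interval arithmetic with integer bounds
   certifies that the first N pivots are positive and the last one negative.
   By the same elimination, D_0, ..., D_j > 0 makes H_j positive, while D_N < 0
   prevents H_N from being positive semidefinite.  As the free cumulants depend
   continuously on (p, q), these signs persist in a neighborhood, which can be
   taken inside ]2/3, 3/4[ x ]3/2, +oo[, away from I and from ]0, 1]^2. *)
Require Import Defs.
From HB Require Import structures.
From Stdlib Require Import BinInt.
From mathcomp Require Import all_boot all_order all_algebra.
From mathcomp Require Import reals zify ssrZ ring lra.

Set Implicit Arguments.
Unset Strict Implicit.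
Unset Printing Implicit Defensive.

Import Order.TTheory GRing.Theory Num.Theory.

Local Open Scope ring_scope.

(** * Noncrossing partitions *)

Section noncrossing_recursion.
Variables (R : comNzRingType) (n : nat).
Implicit Types (A B V W : {set 'I_n}) (P : {set {set 'I_n}}).
Implicit Types (x y : 'I_n) (o : option 'I_n).

(** Ground sets are arbitrary subsets of one fixed ['I_n], so that passing to a part of the ground
    set needs no relabelling. *)
Definition ncpart A : {set {set {set 'I_n}}} :=
  [set P | finset.partition P A & noncrossing P].

Lemma ncpartP P A : reflect
  [/\ set0 \notin P,
      forall W y, W \in P -> y \in W -> y \in A,
      forall y, y \in A -> exists2 W, W \in P & y \in W,
      forall W V y, W \in P -> V \in P -> y \in W -> y \in V -> W = V &
      forall V W, V \in P -> W \in P -> forall a b c d : 'I_n,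
        a \in V -> b \in W -> c \in V -> d \in W ->
        (a < b)%N -> (b < c)%N -> (c < d)%N -> V = W]
  (P \in ncpart A).
Proof.
rewrite inE; apply: (iffP andP).
  move=> [/and3P[/eqP cP /trivIsetP tP P0] ncP]; split => //.
  - by move=> W y WP yW; rewrite -cP; apply/bigcupP; exists W.
  - by move=> y; rewrite -cP => /bigcupP[W WP yW]; exists W.
  - move=> W V y WP VP yW yV; apply/eqP/contraT => /(tP _ _ WP VP).
    by move/disjoint_setI0/setP/(_ y); rewrite !inE yW yV.
  - move=> V W VP WP a b c d aV bW cV dW ab bc cd.
    move/forall_inP: ncP => /(_ _ VP)/forall_inP/(_ _ WP)/forall_inP/(_ _ aV).
    move=> /forall_inP/(_ _ bW)/forall_inP/(_ _ cV)/forall_inP/(_ _ dW).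
    by rewrite ab bc cd /= => /eqP.
move=> [P0 PA AP tP ncP]; split.
  apply/and3P; split => //.
    apply/eqP/setP => y; apply/bigcupP/idP => [[W WP yW]|/AP[W WP yW]].
      exact: PA yW.
    by exists W.
  apply/trivIsetP => V W VP WP; apply: contraNT.
  rewrite -setI_eq0 => /set0Pn[y]; rewrite inE => /andP[yV yW].
  by apply/eqP; exact: tP yV yW.
apply/forall_inP => V VP; apply/forall_inP => W WP.
apply/forall_inP => a aV; apply/forall_inP => b bW.
apply/forall_inP => c cV; apply/forall_inP => d dW.
by apply/implyP => /and3P[ab bc cd]; apply/eqP; exact: (ncP _ _ VP WP a b c d).
Qed.

(** [None] stands for the missing lowest element of the empty set. *)
Definition lowest o A : bool :=
  if o is Some b then (b \in A) && [forall y in A, (b <= y)%N] else A == set0.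

Lemma lowest_ex A : exists o, lowest o A.
Proof.
have [A0|[x xA]] := set_0Vmem A; first by exists None; rewrite /= A0.
case: (arg_minnP (fun y : 'I_n => y : nat) xA) => b bA bmin.
by exists (Some b); apply/andP; split => //; apply/forall_inP => y /bmin.
Qed.

Lemma lowest_uniq o1 o2 A : lowest o1 A -> lowest o2 A -> o1 = o2.
Proof.
case: o1 o2 => [a|] [b|] //=.
- move=> /andP[aA /forall_inP amin] /andP[bA /forall_inP bmin].
  by congr Some; apply: val_inj; apply/eqP; rewrite eqn_leq amin ?bmin.
- by move=> /andP[aA _] /eqP A0; rewrite A0 inE in aA.
- by move=> /eqP A0 /andP[aA _]; rewrite A0 inE in aA.
Qed.

Definition low A : option 'I_n := xchoose (lowest_ex A).

Lemma lowP A : lowest (low A) A. Proof. exact: (xchooseP (lowest_ex A)). Qed.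

(** Here [None] acts as plus infinity: every point is below it. *)
Definition below o y : bool := if o is Some b then (y < b)%N else true.

Definition block o P : {set 'I_n} := if o is Some b then pblock P b else set0.

Lemma block_in o A P : lowest o A -> P \in ncpart A ->
  (A = set0 /\ block o P = set0) \/
  exists b, [/\ o = Some b, block o P \in P, b \in block o P &
                forall y, y \in A -> (b <= y)%N].
Proof.
case: o => [b|] /=; last by move=> /eqP -> _; left.
move=> /andP[bA /forall_inP bmin] /ncpartP[P0 PA AP tP _]; right; exists b.
have [W WP bW] := AP _ bA.
have -> : pblock P b = W.
  apply: def_pblock => //; apply/trivIsetP => V U VP UP; apply: contraNT.
  rewrite -setI_eq0 => /set0Pn[y]; rewrite inE => /andP[yV yW].
  by apply/eqP; exact: tP yV yW.
by split.
Qed.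

(** * Cutting a noncrossing partition at the second element of its first block *)

Section splitting.
Variables (A : {set 'I_n}) (x : 'I_n).
Hypotheses (xA : x \in A) (xmin : forall y, y \in A -> (x <= y)%N).

Definition lower o := [set y in A :\ x | below o y].
Definition upper o := [set y in A :\ x | ~~ below o y].

(* [o] is the second element of the block of [x], if any: [u.1] partitions the
   points between [x] and [o], [u.2] those from [o] on, and [x] is added to the
   block of [o]. *)
Definition glue o (u : {set {set 'I_n}} * {set {set 'I_n}}) :
    {set {set 'I_n}} :=
  [set W : {set 'I_n} | if x \in W then W :\ x == block o u.2
          else (W \in u.1) || (W \in u.2) && (W != block o u.2)].

(** A block of the upper part is a block of [P], or what remains of one after removing [x]. The
    condition [W != set0] discards the remainder of a singleton block of [x]. *)
Definition unglue o P : {set {set 'I_n}} * {set {set 'I_n}} :=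
  ([set W in P | W \subset lower o],
   [set W : {set 'I_n} | [&& W \subset upper o, W != set0 & (W \in P) || (x |: W \in P)]]).

Definition cut o : bool := if o is Some b then b \in A :\ x else true.

Lemma cut_lowest o : cut o -> lowest o (upper o).
Proof.
case: o => [b|] /=.
  move=> bA; apply/andP; split; first by rewrite inE bA /= ltnn.
  by apply/forall_inP => y; rewrite inE /= -leqNgt => /andP[].
by move=> _; apply/eqP/setP => y; rewrite !inE andbF.
Qed.

Lemma lower_lt_upper o y z : y \in lower o -> z \in upper o -> (y < z)%N.
Proof.
rewrite [y \in _]inE [z \in _]inE; case: o => [b|] /=; last by rewrite andbF.
by rewrite -leqNgt => /andP[_ yb] /andP[_]; exact: leq_trans.
Qed.

Lemma lower_upperF o y : y \in lower o -> y \in upper o -> False.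
Proof. by move=> /lower_lt_upper h /h; rewrite ltnn. Qed.

Lemma lower_gt o y : y \in lower o -> (x < y)%N.
Proof.
rewrite !inE => /andP[/andP[yx /xmin]]; rewrite leq_eqVlt => /orP[/eqP e|//].
by rewrite (val_inj e) eqxx in yx.
Qed.

Lemma upper_gt o y : y \in upper o -> (x < y)%N.
Proof.
rewrite !inE => /andP[/andP[yx /xmin]]; rewrite leq_eqVlt => /orP[/eqP e|//].
by rewrite (val_inj e) eqxx in yx.
Qed.

Lemma lower_neq o : x \notin lower o.
Proof. by apply/negP => /lower_gt; rewrite ltnn. Qed.

Lemma upper_neq o : x \notin upper o.
Proof. by apply/negP => /upper_gt; rewrite ltnn. Qed.

Section glue_facts.
Variables (o : option 'I_n) (P1 P2 : {set {set 'I_n}}).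
Hypotheses (co : cut o) (P1nc : P1 \in ncpart (lower o))
  (P2nc : P2 \in ncpart (upper o)).
Let V := block o P2.

Let Vupper y : y \in V -> y \in upper o.
Proof.
rewrite /V; have [[_ ->]|[b [_ VP _ _]]] := block_in (cut_lowest co) P2nc.
  by rewrite inE.
by have /ncpartP[_ + _ _ _] := P2nc; apply.
Qed.

Let xV : x \notin V.
Proof. by apply/negP => /Vupper; apply/negP/upper_neq. Qed.

Let glueE W : (W \in glue o (P1, P2)) = if x \in W then W :\ x == V
          else (W \in P1) || (W \in P2) && (W != V).
Proof. by rewrite inE. Qed.

Let glue_notin W : W \in P1 \/ W \in P2 -> x \notin W.
Proof.
move=> h; apply/negP => xW; case: h => WP.
  by have /ncpartP[_ + _ _ _] := P1nc => /(_ _ _ WP xW); apply/negP/lower_neq.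
by have /ncpartP[_ + _ _ _] := P2nc => /(_ _ _ WP xW); apply/negP/upper_neq.
Qed.

Let glueP W : W \in glue o (P1, P2) ->
  [\/ W = x |: V, W \in P1 | W \in P2 /\ W != V].
Proof.
rewrite glueE; case: ifPn => [xW /eqP <-|_ /orP[WP|/andP[WP WV]]].
- by constructor 1; rewrite setD1K.
- by constructor 2.
- by constructor 3.
Qed.

Let glueV : x |: V \in glue o (P1, P2).
Proof. by rewrite glueE setU11 setU1K. Qed.

(** Lower points precede upper points, which excludes crossings between the two sides, and [x]
    precedes them all. A crossing of [x |: V] with a block of [P2] would already occur inside [P2],
    with the least point of [V] in place of [x]. *)
Lemma glue_ncpart : glue o (P1, P2) \in ncpart A.
Proof.
have /ncpartP[P10 P1A AP1 tP1 nc1] := P1nc.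
have /ncpartP[P20 P2A AP2 tP2 nc2] := P2nc.
have disj W1 W2 y : W1 \in P1 -> W2 \in P2 -> y \in W1 -> y \in W2 -> False.
  by move=> h1 h2 /(P1A _ _ h1) + /(P2A _ _ h2); exact: lower_upperF.
have VP2 y : y \in V -> V \in P2.
  move=> yV; have [[_ h]|[b [_ VP _ _]]] := block_in (cut_lowest co) P2nc => //.
  by rewrite /V h inE in yV.
have xP1 W1 : W1 \in P1 -> x \notin W1 by move=> h; apply: glue_notin; left.
have xP2 W1 : W1 \in P2 -> x \notin W1 by move=> h; apply: glue_notin; right.
apply/ncpartP; split.
- rewrite glueE inE (negbTE P10) (negbTE P20) //.
- move=> W y /glueP[->|/P1A h|[/P2A h _]].
  + rewrite !inE => /orP[/eqP-> //|/Vupper].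
    by rewrite !inE => /andP[/andP[]].
  + by move=> /h; rewrite !inE => /andP[/andP[]].
  + by move=> /h; rewrite !inE => /andP[/andP[]].
- move=> y yA; have [->|yx] := eqVneq y x.
    by exists (x |: V); rewrite ?setU11.
  have [/AP1[W WP yW]|yl] := boolP (y \in lower o).
    by exists W => //; rewrite glueE (negbTE (xP1 _ WP)) WP.
  have /AP2[W WP yW] : y \in upper o.
    by move: yl; rewrite !inE yx yA /=.
  have [WV|WV] := eqVneq W V.
    by exists (x |: V) => //; rewrite inE -WV yW orbT.
  by exists W => //; rewrite glueE (negbTE (xP2 _ WP)) WP WV orbT.
- move=> W W' y /glueP[->|WP|[WP WV]] /glueP[->|WP'|[WP' WV']] //.
  + rewrite in_setU1 => /orP[/eqP->|yV yW]; first by rewrite (negbTE (xP1 _ WP')).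
    by case: (disj _ _ _ WP' (VP2 _ yV) yW yV).
  + rewrite in_setU1 => /orP[/eqP->|yV yW]; first by rewrite (negbTE (xP2 _ WP')).
    by case/eqP: WV'; exact: (tP2 _ _ _ WP' (VP2 _ yV) yW yV).
  + rewrite in_setU1 => yW /orP[/eqP e|yV].
      by rewrite e (negbTE (xP1 _ WP)) in yW.
    by case: (disj _ _ _ WP (VP2 _ yV) yW yV).
  + exact: tP1.
  + by move=> yW yW'; case: (disj _ _ _ WP WP' yW yW').
  + rewrite in_setU1 => yW /orP[/eqP e|yV].
      by rewrite e (negbTE (xP2 _ WP)) in yW.
    by case/eqP: WV; exact: (tP2 _ _ _ WP (VP2 _ yV) yW yV).
  + by move=> yW yW'; case: (disj _ _ _ WP' WP yW' yW).
  + exact: tP2.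
- move=> W W' /glueP[->|WP|[WP WV]] /glueP[->|WP'|[WP' WV']] // a b c d.
  + rewrite in_setU1 => _ bW /[!in_setU1] cV dW ab bc cd.
    case/orP: cV => [/eqP e|cV].
      by have := lower_gt (P1A _ _ WP' bW); rewrite -e ltnNge ltnW.
    by have := lower_lt_upper (P1A _ _ WP' dW) (Vupper cV); rewrite ltnNge ltnW.
  + rewrite in_setU1 => _ bW /[!in_setU1] cV dW ab bc cd.
    case/orP: cV => [/eqP e|cV].
      by have := upper_gt (P2A _ _ WP' bW); rewrite -e ltnNge ltnW.
    have [[_ h]|[b0 [_ VP b0V b0min]]] := block_in (cut_lowest co) P2nc.
      by rewrite /V h inE in cV.
    (* [b0], the least point of [V], takes the place of [a], which may be [x]. *)
    case/eqP: (WV'); apply/esym/(nc2 _ _ VP WP' b0 b c d) => //.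
    have := b0min _ (P2A _ _ WP' bW); rewrite leq_eqVlt => /orP[/eqP e|//].
    by case/eqP: WV'; apply: tP2 bW _ => //; rewrite -(val_inj e).
  + move=> aW /[!in_setU1] bV cW dV ab bc cd.
    case/orP: bV => [/eqP e|bV].
      by have := lower_gt (P1A _ _ WP aW); rewrite -e ltnNge ltnW.
    by have := lower_lt_upper (P1A _ _ WP cW) (Vupper bV); rewrite ltnNge ltnW.
  + exact: nc1.
  + move=> aW bW' cW dW' ab bc cd.
    by have := lower_lt_upper (P1A _ _ WP cW) (P2A _ _ WP' bW'); rewrite ltnNge ltnW.
  + move=> aW /[!in_setU1] bV cW dV ab bc cd.
    case/orP: bV => [/eqP e|bV].
      by have := upper_gt (P2A _ _ WP aW); rewrite -e ltnNge ltnW.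
    case/orP: dV => [/eqP e|dV].
      by have := upper_gt (Vupper bV); rewrite -e ltnNge ltnW// (ltn_trans bc).
    by case/eqP: WV; apply: (nc2 _ _ WP (VP2 _ bV) a b c d).
  + move=> aW bW' cW dW' ab bc cd.
    by have := lower_lt_upper (P1A _ _ WP' bW') (P2A _ _ WP aW); rewrite ltnNge ltnW.
  + exact: nc2.
Qed.

Lemma pblock_glue : pblock (glue o (P1, P2)) x = x |: V.
Proof.
have /ncpartP[_ _ _ t _] := glue_ncpart.
apply: def_pblock => //; rewrite ?setU11//.
apply/trivIsetP => U W UP WP; apply: contraNT.
rewrite -setI_eq0 => /set0Pn[y]; rewrite inE => /andP[yU yW].
by apply/eqP; exact: t yU yW.
Qed.

(** The cutting point [o] can be read off the glued partition, so gluings for distinct [o] never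
    coincide. *)
Lemma low_glue : low (pblock (glue o (P1, P2)) x :\ x) = o.
Proof.
rewrite pblock_glue setU1K//.
apply: (lowest_uniq (lowP _)).
have [[u0 V0]|[b [oE VP bV bmin]]] := block_in (cut_lowest co) P2nc.
  have := cut_lowest co; rewrite /V V0 u0.
  by case: (o).
rewrite [X in lowest X]oE; apply/andP; split; first exact: bV.
by apply/forall_inP => y /Vupper; exact: bmin.
Qed.

Lemma glueK : unglue o (glue o (P1, P2)) = (P1, P2).
Proof.
have /ncpartP[P10 P1A _ tP1 _] := P1nc.
have /ncpartP[P20 P2A _ tP2 _] := P2nc.
congr pair; apply/setP => W; rewrite inE.
- apply/andP/idP.
    move=> [WP /subsetP Wl]; case/glueP: WP => // [We|[WP WV]].
      by case/negP: (lower_neq o); apply: Wl; rewrite We setU11.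
    have /set0Pn[y yW] : W != set0 by apply: contraNneq P20 => <-.
    by case: (lower_upperF (Wl _ yW) (P2A _ _ WP yW)).
  move=> WP; split; last by apply/subsetP => y /(P1A _ _ WP).
  by rewrite glueE (negbTE (glue_notin (or_introl WP))) WP.
- apply/and3P/idP.
    move=> [/subsetP Wu /set0Pn[y yW]].
    have xW : x \notin W by apply/negP => /Wu; apply/negP/upper_neq.
    move=> /orP[/glueP[We|WP|[]]|] //.
    + by rewrite We setU11 in xW.
    + by case: (lower_upperF (P1A _ _ WP yW) (Wu _ yW)).
    rewrite glueE setU11 setU1K// => /eqP We.
    have [[_ h]|[b [_ VP _ _]]] := block_in (cut_lowest co) P2nc.
      by rewrite We /V h inE in yW.
    by rewrite We.
  move=> WP; split.
  + by apply/subsetP => y /(P2A _ _ WP).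
  + by apply: contraNneq P20 => <-.
  + have xW := glue_notin (or_intror WP).
    rewrite !glueE (negbTE xW) WP setU11 setU1K//.
    by case: eqVneq; rewrite ?orbT.
Qed.

Variable kappa : nat -> R.

(* [o] is the lowest element of the ground set of [P] ([None] if it is empty);
   its block is weighted as if it had [s] more elements. *)
Definition weight s o P : R :=
  kappa (s + #|block o P|) * \prod_(W in P | W != block o P) kappa #|W|.

(** The block of [x] is that of [o] with one more element, hence the shift to [s.+1]; for [o = None]
    the latter block is empty. The blocks of the lower part keep their own cumulants. *)
Lemma weight_glue s : weight s (Some x) (glue o (P1, P2)) =
  (\prod_(W in P1) kappa #|W|) * weight s.+1 o P2.
Proof.
have /ncpartP[P10 P1A _ tP1 _] := P1nc.
have /ncpartP[P20 P2A _ tP2 _] := P2nc.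
rewrite /weight /= pblock_glue cardsU1 xV addnA addn1 mulrCA; congr (_ * _).
(* The blocks other than that of [x] are split into those of [P1] and those of [P2]. *)
rewrite (bigID (fun W => W \in P1)) /=; congr (_ * _); apply: eq_bigl => W.
  apply/andP/idP => [[]//|WP]; split => //.
  have xW := glue_notin (or_introl WP).
  rewrite glueE (negbTE xW) WP /=.
  by apply: contraNneq xW => ->; rewrite setU11.
apply/andP/andP.
  move=> [/andP[/glueP[->|->|[WP WV] _ _]]]//; by rewrite eqxx.
move=> [WP WV]; have xW := glue_notin (or_intror WP).
split.
  rewrite glueE (negbTE xW) WP WV orbT /=.
  by apply: contraNneq xW => ->; rewrite setU11.
apply/negP => WP1.
have /set0Pn[y yW] : W != set0 by apply: contraNneq P20 => <-.
exact: lower_upperF (P1A _ _ WP1 yW) (P2A _ _ WP yW).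
Qed.

End glue_facts.
Section unglue_facts.
Variables (o : option 'I_n) (P : {set {set 'I_n}}).
Hypotheses (Pnc : P \in ncpart A) (Po : low (pblock P x :\ x) = o).
Let B := pblock P x :\ x.

Let Blow : lowest o B. Proof. by rewrite -Po; exact: lowP. Qed.

Let xB : x |: B \in P /\ pblock P x = x |: B.
Proof.
have xl : lowest (Some x) A.
  by apply/andP; split => //; apply/forall_inP => y; exact: xmin.
have [[A0 _]|[b [[<-] VP xV _]]] := block_in xl Pnc.
  by have := xA; rewrite A0 inE.
by split; rewrite setD1K.
Qed.

Let xNB : x \notin B. Proof. by rewrite !inE eqxx. Qed.

Let BA y : y \in B -> y \in A.
Proof.
have /ncpartP[_ PA _ _ _] := Pnc.
by move=> yB; apply: PA xB.1 _; rewrite in_setU1 yB orbT.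
Qed.

Lemma cut_unglue : cut o.
Proof.
have := Blow; case: (o) => [b|//] /andP[bB _].
by rewrite /cut in_setD1 (BA bB) andbT; apply: contraNneq xNB => <-.
Qed.

Let B_upper y : y \in B -> y \in upper o.
Proof.
move=> yB; rewrite inE in_setD1 (BA yB) andbT.
apply/andP; split; first by apply: contraNneq xNB => <-.
have := Blow; case: (o) => [b|] /=.
  by move=> /andP[_ /forall_inP/(_ _ yB)]; rewrite -leqNgt.
by move=> /eqP B0; rewrite B0 inE in yB.
Qed.

Let xuniq W : W \in P -> x \in W -> W = x |: B.
Proof.
have /ncpartP[_ _ _ tP _] := Pnc.
by move=> WP xW; apply: tP xW (setU11 _ _) => //; exact: xB.1.
Qed.

(* A block meeting both sides of the second element of the block of [x]
   would cross the latter. *)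
Let lower_or_upper W : W \in P -> x \notin W ->
  (forall y, y \in W -> y \in lower o) \/ (forall y, y \in W -> y \in upper o).
Proof.
have /ncpartP[P0 PA AP tP nc] := Pnc.
move=> WP xW.
have WA' y : y \in W -> y \in A :\ x.
  move=> yW; rewrite in_setD1 (PA _ _ WP yW) andbT.
  by apply: contraNneq xW => <-.
have := Blow; case oE: (o) => [b|]; last by left => y /WA' h; rewrite inE h.
move=> /andP[bB /forall_inP bmin].
have [/forall_inP h|/forall_inPn[y yW yb]] :=
  boolP [forall y in W, below (Some b) y].
  by left => y yW; rewrite inE WA' ?h.
have [/forall_inP h|/forall_inPn[z zW zb]] :=
  boolP [forall y in W, ~~ below (Some b) y].
  by right => z zW; rewrite inE WA' ?h.
case/negP: (xW); rewrite negbK /= in zb; rewrite /= -leqNgt in yb.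
have -> : W = x |: B; last exact: setU11.
have bW : b \notin W.
  apply: contraNN xNB => bW.
  suff WE : W = x |: B by rewrite WE setU11 in xW.
  by apply: (tP _ _ b WP xB.1 bW); rewrite in_setU1 bB orbT.
suff : x |: B = W by [].
apply: (nc _ _ xB.1 WP x z b y) => //; rewrite ?in_setU1 ?eqxx ?bB ?orbT//.
- by apply: (lower_gt (o := Some b)); rewrite inE WA'.
- rewrite ltn_neqAle yb andbT; apply: contraNneq bW => by_.
  by rewrite (val_inj by_).
Qed.

Lemma unglue_lower : (unglue o P).1 \in ncpart (lower o).
Proof.
have /ncpartP[P0 PA AP tP nc] := Pnc.
apply/ncpartP; split.
- by rewrite inE (negbTE P0).
- by move=> W y; rewrite inE => /andP[_ /subsetP]; apply.
- move=> y yl; have /AP[W WP yW] : y \in A.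
    by move: yl; rewrite inE in_setD1 => /andP[/andP[]].
  exists W => //; rewrite inE WP /=.
  have xW : x \notin W.
    apply/negP => /(xuniq WP) WE; move: yW; rewrite WE in_setU1.
    move=> /orP[/eqP e|/B_upper]; last exact: lower_upperF.
    by have := lower_gt yl; rewrite e ltnn.
  have [h|h] := lower_or_upper WP xW; first exact/subsetP.
  by case: (lower_upperF yl (h _ yW)).
- by move=> W V y; rewrite !inE => /andP[WP _] /andP[VP _]; exact: tP.
- by move=> W V; rewrite !inE => /andP[WP _] /andP[VP _]; exact: nc.
Qed.

(** Each block here is a block of [P] with [x] removed, and both disjointness and the absence of
    crossings pass to subsets. *)
Lemma unglue_upper : (unglue o P).2 \in ncpart (upper o).
Proof.
have /ncpartP[P0 PA AP tP nc] := Pnc.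
have lift W : W \in (unglue o P).2 ->
    exists2 W', W' \in P & W \subset W' /\ W = W' :\ x.
  rewrite inE => /and3P[/subsetP Wu _].
  have xW : x \notin W by apply/negP => /Wu; apply/negP/upper_neq.
  move=> /orP[WP|WP].
    exists W => //; split => //; apply/setP => y; rewrite in_setD1.
    by case: eqVneq => // ->; rewrite (negbTE xW).
  by exists (x |: W) => //; rewrite subsetUr setU1K.
apply/ncpartP; split.
- by rewrite inE eqxx andbF.
- by move=> W y; rewrite inE => /and3P[/subsetP Wu _ _]; exact: Wu.
- move=> y yu; have /AP[W WP yW] : y \in A.
    by move: yu; rewrite inE in_setD1 => /andP[/andP[]].
  have [xW|xW] := boolP (x \in W).
    exists B; last first.
      move: yW; rewrite (xuniq WP xW) in_setU1 => /orP[/eqP e|//].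
      by have := upper_gt yu; rewrite e ltnn.
    rewrite inE xB.1 orbT andbT; apply/andP; split.
      by apply/subsetP => z; exact: B_upper.
    apply/set0Pn; exists y; move: yW; rewrite (xuniq WP xW) in_setU1.
    move=> /orP[/eqP e|//]; by have := upper_gt yu; rewrite e ltnn.
  exists W => //; rewrite inE WP /= andbT; apply/andP; split.
    have [h|h] := lower_or_upper WP xW; last exact/subsetP.
    by case: (lower_upperF (h _ yW) yu).
  by apply/set0Pn; exists y.
- move=> W V y /lift[W' WP [/subsetP WW' ->]] /lift[V' VP [/subsetP VV' ->]].
  by move=> /setD1P[_ yW] /setD1P[_ yV]; rewrite (tP _ _ _ WP VP yW yV).
- move=> W V /lift[W' WP [/subsetP WW' WE]] /lift[V' VP [/subsetP VV' VE]].
  move=> a b c d /WW' aW /VV' bV /WW' cW /VV' dV ab bc cd.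
  by rewrite WE VE (nc _ _ WP VP a b c d).
Qed.

Let block_unglue : block o (unglue o P).2 = B.
Proof.
have [[u0 ->]|[b [oE VP bV bmin]]] := block_in (cut_lowest cut_unglue) unglue_upper.
  by apply/setP => y; rewrite inE; apply/esym/negbTE/negP => /B_upper; rewrite u0 inE.
have /ncpartP[_ _ _ t2 _] := unglue_upper.
have bB : b \in B by have := Blow; rewrite oE => /andP[].
apply: (t2 _ _ b VP _ bV bB).
rewrite inE xB.1 orbT andbT; apply/andP; split.
  by apply/subsetP => z; exact: B_upper.
by apply/set0Pn; exists b.
Qed.

Lemma unglueK : glue o (unglue o P) = P.
Proof.
have /ncpartP[P0 PA AP tP nc] := Pnc.
apply/setP => W; rewrite inE block_unglue.
case: ifPn => xW.
  apply/eqP/idP => [WE|WP].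
    by rewrite -(setD1K xW) WE xB.1.
  by rewrite (xuniq WP xW) setU1K.
rewrite inE inE; apply/orP/idP.
  move=> [/andP[]//|/andP[/and3P[_ _ /orP[//|xWP]] WB]].
  case/eqP: WB; apply/setP => y; have := xuniq xWP (setU11 _ _).
  move=> /setP/(_ y); rewrite !in_setU1; case: eqVneq => //= -> _.
  by rewrite (negbTE xW) (negbTE xNB).
move=> WP; have W0 : W != set0 by apply: contraNneq P0 => <-.
have [h|h] := lower_or_upper WP xW.
  by left; rewrite WP; exact/subsetP.
right; rewrite WP W0 andbT /=; apply/andP; split; first exact/subsetP.
apply: contraNneq xW => WB; case/set0Pn: W0 => y yW.
have -> : W = x |: B; last exact: setU11.
by apply: (tP _ _ y WP xB.1 yW); rewrite in_setU1 -WB yW orbT.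
Qed.

End unglue_facts.

End splitting.

(** The number of points of [A] below [b] takes each value less than [#|A|] once, by induction on
    removing the largest point. This turns a sum over the second element of a block into one over
    the number of points before it. *)
Lemma sum_rank A (F : nat -> R) :
  \sum_(b in A) F #|[set y in A | (y < b)%N]| = \sum_(j < #|A|) F j.
Proof.
have [k cA] : exists k, #|A| = k by exists #|A|.
rewrite cA; elim: k A cA => [|k IH] A cA.
  by rewrite (cards0_eq cA) big_set0 big_ord0.
have /set0Pn[z zA] : A != set0 by rewrite -card_gt0 cA.
case: (arg_maxnP (fun y : 'I_n => y : nat) zA) => c /= cA1 cmax {z zA}.
have cAm : c \in A by exact: cA1.
have cA' : #|A :\ c| = k by move: cA; rewrite (cardsD1 c) cAm => -[].
rewrite (bigD1 c)//= big_ord_recr/= addrC; congr (_ + F _); last first.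
  rewrite -cA'; apply: eq_card => y; rewrite !inE.
  have [->|yc] := eqVneq y c; first by rewrite ltnn andbF.
  have [yA|//] := boolP (y \in A).
  by rewrite ltn_neqAle (cmax _ yA) yc.
rewrite -(IH _ cA'); apply: eq_big => [b|b /andP[bA bc]]; first by rewrite !inE andbC.
congr F; apply: eq_card => y; rewrite !inE.
have [->|//] := eqVneq y c.
by rewrite ltnNge (cmax _ bA) andbF.
Qed.

(** * Recursion for weighted sums over noncrossing partitions *)

Section recursion.
Variables (kappa m : nat -> R) (g : nat -> nat -> R) (N : nat).
Hypotheses (g0 : forall s, g 0 s = kappa s)
  (gS : forall k s, g k.+1 s = \sum_(j < k.+1) m j * g (k - j) s.+1)
  (m0 : m 0 = 1) (mS : forall k, (k.+1 < N)%N -> m k.+1 = g k.+1 0).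

Lemma ncpart0 : ncpart set0 = [set set0].
Proof.
apply/setP => P; rewrite [RHS]inE; apply/idP/eqP => [/ncpartP[P0 PA _ _ _]|->].
  apply/setP => W; rewrite !inE; apply/negP => WP.
  have /set0Pn[y yW] : W != set0 by apply: contraNneq P0 => <-.
  by have := PA _ _ WP yW; rewrite inE.
by apply/ncpartP; split => [|W y|y|W V y|V W]; rewrite !inE.
Qed.

(** Strong induction on the size of the ground set. For a fixed cutting point [o], gluing is a
    bijection from pairs of partitions; the lower part sums to a moment and the upper part to [g]
    with shift [s.+1]. Moments are identified with [g] only strictly below [N], as the induction
    that uses this lemma requires. *)
Lemma sum_weight k : (k <= N)%N -> forall A s o, #|A| = k -> lowest o A ->
  \sum_(P in ncpart A) weight kappa s o P = g k s.
Proof.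
elim/ltn_ind: k => k IH kN A s o cA.
case: o => [x|] => [/andP[xA /forall_inP xmin]|/eqP A0]; last first.
  rewrite A0 ncpart0 big_set1 /weight /= cards0 addn0 big1 ?mulr1; last first.
    by move=> W; rewrite inE.
  by rewrite -cA A0 cards0 g0.
case: k IH kN cA => [|k] IH kN cA; first by rewrite (cards0_eq cA) inE in xA.
(* With [s = 0] the weight of a partition is its ordinary product of cumulants, so the induction
   hypothesis also gives the unweighted sums. *)
have sum1 A1 : (#|A1| < k.+1)%N -> \sum_(P in ncpart A1) \prod_(W in P) kappa #|W| = m #|A1|.
  move=> A1k; have [->|A1n] := eqVneq A1 set0.
    by rewrite ncpart0 big_set1 big_set0 cards0 m0.
  have [o1 lo1] := lowest_ex A1.
  have -> : m #|A1| = g #|A1| 0.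
    move: A1n A1k; rewrite -card_gt0; case: #|A1| => // j _ jk.
    exact/mS/(leq_trans jk).
  rewrite -(IH _ A1k (leq_trans (ltnW A1k) kN) A1 0%N o1)//; apply: eq_bigr => P Pnc; rewrite /weight.
  have [[A10 _]|[b [_ VP _ _]]] := block_in lo1 Pnc.
    by rewrite A10 eqxx in A1n.
  by rewrite (bigD1 (block o1 P))//= add0n.
have cA' : #|A :\ x| = k by move: cA; rewrite (cardsD1 x) xA => -[].
have cC o : #|upper A x o| = (k - #|lower A x o|)%N.
  rewrite -cA' -(cardsID [set y | below o y] (A :\ x)).
  have -> : (A :\ x) :&: [set y | below o y] = lower A x o.
    by apply/setP => y; rewrite !inE.
  by rewrite addKn; apply: eq_card => y; rewrite !inE andbC.
have lk o : (#|lower A x o| <= k)%N.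
  by rewrite -cA'; apply: subset_leq_card; apply/subsetP => y; rewrite inE => /andP[].
transitivity (\sum_(o | cut A x o) m #|lower A x o| * g (k - #|lower A x o|) s.+1).
  (* Partitions are grouped by the second element of the block of [x]; [glue] parametrizes each
     group. *)
  rewrite (partition_big (fun P => low (pblock P x :\ x)) (cut A x)) /=; last first.
    by move=> P Pnc; exact: (cut_unglue xA xmin Pnc).
  apply: eq_bigr => o co.
  rewrite (reindex_onto (glue x o) (unglue A x o)) /=; last first.
    by move=> P /andP[Pnc /eqP Po]; exact: unglueK.
  rewrite -sum1 ?ltnS// -cC -(IH _ _ _ (upper A x o) s.+1 o)//; last 3 first.
  - by rewrite cC ltnS leq_subr.
  - by rewrite cC (leq_trans (leq_subr _ _)) 1?ltnW.
  - exact: cut_lowest.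
  rewrite big_distrlr /= pair_big /=.
  rewrite (eq_bigl (fun u => (u.1 \in ncpart (lower A x o)) &&
      (u.2 \in ncpart (upper A x o)))) => [|[P1 P2]]; last first.
    apply/andP/andP => /= [[/andP[h1 /eqP h2] /eqP e]|[h1 h2]].
      by have := unglue_lower xA xmin h1 h2; have := unglue_upper xA xmin h1 h2; rewrite e.
    rewrite (glue_ncpart xA xmin co h1 h2) (low_glue xA xmin co h1 h2) eqxx.
    by split => //; apply/eqP; exact: glueK.
  apply: eq_bigr => -[P1 P2] /andP[h1 h2]; exact: (weight_glue xA xmin co h1 h2).
(* The case [None], where [x] is alone in its block, gives the last term [j = k]; the other cutting
   points are counted by rank. *)
rewrite gS big_ord_recr /= subnn (bigD1 None)//= addrC.
have -> : #|lower A x None| = k.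
  by rewrite -cA'; apply: eq_card => y; rewrite !inE andbT.
rewrite subnn; congr (_ + _).
have := sum_rank (A :\ x) (fun j => m j * g (k - j)%N s.+1).
rewrite cA' => <-.
rewrite (reindex_omap Some id) /=; last by case.
by apply: eq_bigl => b; rewrite eqxx !andbT.
Qed.

End recursion.

End noncrossing_recursion.

(** The sum over [NC k] is the weighted sum over the full ground set with [s = 0]; strong induction
    supplies the smaller moments that [sum_weight] needs. *)
Lemma moment_cumulant_rec (R : realType) (m kappa : nat -> R) g :
  moment_cumulant m kappa -> m 0 = 1 ->
  (forall s, g 0 s = kappa s) ->
  (forall k s, g k.+1 s = \sum_(j < k.+1) m j * g (k - j)%N s.+1) ->
  forall k, (0 < k)%N -> m k = g k 0.
Proof.
move=> mk m0 g0 gS k; elim/ltn_ind: k => -[//|k] IH _.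
have lo : lowest (Some ord0) [set: 'I_k.+1].
  by apply/andP; split; [rewrite inE | apply/forall_inP].
have mS j : (j.+1 < k.+1)%N -> m j.+1 = g j.+1 0 by move=> /IH; exact.
rewrite mk// -(sum_weight g0 gS m0 mS (leqnn _) 0 _ lo) ?cardsT ?card_ord//.
apply: eq_bigr => P Pnc; rewrite /weight.
have [[/setP/(_ ord0)]|[b [_ VP _ _]]] := block_in lo Pnc; first by rewrite !inE.
by rewrite [LHS](bigD1 (block (Some ord0) P)).
Qed.

Lemma moment_cumulant_triangle (R : realType) (m kappa : nat -> R) :
  moment_cumulant m kappa -> m 0 = 1 -> exists g : nat -> nat -> R,
    [/\ forall s, g 0 s = kappa s,
        forall k s, g k.+1 s = \sum_(j < k.+1) m j * g (k - j)%N s.+1 &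
        forall k, (0 < k)%N -> m k = g k 0].
Proof.
move=> mk m0.
(* [G k] lists the rows [g k], ..., [g 0], since each row depends on all the earlier ones. *)
pose G := fix G k : seq (nat -> R) := if k is k'.+1 then
  (fun s => \sum_(j < k'.+1) m j * nth kappa (G k') j s.+1) :: G k' else [:: kappa].
pose g k := head kappa (G k).
have Gg k : forall j, (j <= k)%N -> nth kappa (G k) j = g (k - j)%N.
  elim: k => [|k IH] [|j] //= jk.
  by rewrite subSS IH.
have g0 s : g 0 s = kappa s by [].
have gS k s : g k.+1 s = \sum_(j < k.+1) m j * g (k - j)%N s.+1.
  by rewrite /g /=; apply: eq_bigr => j _; rewrite Gg// -ltnS.
by exists g; split => //; exact: moment_cumulant_rec mk m0 g0 gS.
Qed.

(** * Leading minors and positive semidefiniteness *)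

Section schur_complement.
Variable R : realFieldType.
Implicit Types (A : nat -> nat -> R) (v : nat -> R).

(** Infinite arrays let the elimination be iterated without changing the type of the matrix. *)
Definition lead A n : 'M[R]_n.+1 := \matrix_(i < n.+1, j < n.+1) A i j.

Definition schur A i j : R := A i.+1 j.+1 - A i.+1 0%N * (A 0%N j.+1 / A 0%N 0%N).

Lemma det_lead0 A : \det (lead A 0) = A 0%N 0%N.
Proof. by rewrite det_mx11 mxE. Qed.

(** Block factorization into a lower triangular matrix with diagonal blocks [a] and the Schur
    complement, and an upper unitriangular one. *)
Lemma det_leadS A n : A 0%N 0%N != 0 ->
  \det (lead A n.+1) = A 0%N 0%N * \det (lead (schur A) n).
Proof.
move=> a0; set a := A 0%N 0%N.
pose b : 'rV_n.+1 := \row_j (A 0%N j.+1 / a).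
pose c : 'cV_n.+1 := \col_i A i.+1 0%N.
have -> : lead A n.+1 = block_mx a%:M 0 c (lead (schur A) n) *m
    block_mx 1%:M b 0 1%:M :> 'M_(1 + n.+1).
  rewrite mulmx_block !mulmx1 !mulmx0 ?mul0mx !addr0.
  apply/matrixP => i j; rewrite -[i]splitK -[j]splitK.
  case: (split i) => i'; case: (split j) => j'; rewrite /= ?ord1.
  - by rewrite block_mxEul !mxE /= mulr1n.
  - by rewrite block_mxEur mul_scalar_mx !mxE /= mulrC divfK.
  - by rewrite block_mxEdl !mxE.
  - by rewrite block_mxEdr !mxE big_ord1 !mxE /= /schur -/a addrC subrK.
rewrite det_mulmx (det_lblock (a%:M : 'M_1)) (det_ublock (1%:M : 'M_1)).
by rewrite !det_scalar1 det1 !mulr1.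
Qed.

Definition form A n v : R := \sum_(i < n.+1) \sum_(j < n.+1) v i * A i j * v j.

(** Completing the square in the coordinate [v 0]. *)
Lemma formS A n v : (forall i j, A i j = A j i) -> A 0%N 0%N != 0 ->
  form A n.+1 v =
  A 0%N 0%N * (v 0%N + (\sum_(j < n.+1) A 0%N j.+1 * v j.+1) / A 0%N 0%N) ^+ 2 +
  form (schur A) n (v \o succn).
Proof.
move=> symA a0; rewrite /form big_ord_recl [X in X + _]big_ord_recl /=.
set a := A 0%N 0%N; set s := \sum_(j < n.+1) A 0%N j.+1 * v j.+1.
have -> : \sum_(j < n.+1) v 0%N * A 0%N (bump 0 j) * v (bump 0 j) = v 0%N * s.
  by rewrite mulr_sumr; apply: eq_bigr => j _; rewrite mulrA.
have -> : \sum_(i < n.+1) \sum_(j < n.+2) v (bump 0 i) * A (bump 0 i) j * v j =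
    s * v 0%N + \sum_(i < n.+1) \sum_(j < n.+1) v i.+1 * A i.+1 j.+1 * v j.+1.
  rewrite mulr_suml -big_split; apply: eq_bigr => i _.
  by rewrite big_ord_recl /=; congr (_ + _); rewrite symA [v i.+1 * _]mulrC.
have -> : \sum_(i < n.+1) \sum_(j < n.+1) v i.+1 * schur A i j * v j.+1 =
    \sum_(i < n.+1) \sum_(j < n.+1) v i.+1 * A i.+1 j.+1 * v j.+1 - s * s / a.
  rewrite -mulrA mulr_suml -sumrB; apply: eq_bigr => i _.
  rewrite [X in _ - X]mulrA mulr_sumr mulr_suml -sumrB; apply: eq_bigr => j _.
  by rewrite /schur (symA i.+1 0%N) -/a; field.
by field.
Qed.

Definition psd A n : Prop := forall v, 0 <= form A n v.

Lemma psdS A n : (forall i j, A i j = A j i) -> 0 < A 0%N 0%N ->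
  psd A n.+1 <-> psd (schur A) n.
Proof.
move=> symA a0; split=> psdA v; last first.
  by rewrite formS ?gt_eqF// addr_ge0// mulr_ge0 ?sqr_ge0// ltW.
(* The first coordinate is chosen to make the completed square vanish. *)
pose w k := if k is k'.+1 then v k'
            else - ((\sum_(j < n.+1) A 0%N j.+1 * v j) / A 0%N 0%N).
by have := psdA w; rewrite formS ?gt_eqF// addNr expr0n mulr0 add0r.
Qed.

Lemma schur_sym A : (forall i j, A i j = A j i) -> forall i j, schur A i j = schur A j i.
Proof.
move=> symA i j; rewrite /schur (symA i.+1 j.+1) (symA i.+1 0%N) (symA j.+1 0%N).
by rewrite mulrCA.
Qed.

(** One half of Sylvester's criterion. Dividing by the first pivot turns the minors of [A] into
    those of its Schur complement, to which the induction applies. *)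
Lemma psd_det_gt0 A n : (forall i j, A i j = A j i) ->
  (forall j, (j <= n)%N -> 0 < \det (lead A j)) -> psd A n.
Proof.
elim: n A => [|n IH] A symA dA; have := dA 0%N isT; rewrite det_lead0 => a0.
  move=> v; rewrite /form !big_ord1 mulrAC -expr2 mulr_ge0 ?sqr_ge0//.
  exact: ltW.
apply/psdS => //; apply: IH => [|j jn]; first exact: schur_sym.
by have := dA j.+1 jn; rewrite det_leadS ?gt_eqF// pmulr_rgt0.
Qed.

(** The same elimination ends in a negative one by one matrix, for which the vector 1 is a
    witness. *)
Lemma not_psd_det_lt0 A n : (forall i j, A i j = A j i) ->
  (forall j, (j < n)%N -> 0 < \det (lead A j)) -> \det (lead A n) < 0 -> ~ psd A n.
Proof.
elim: n A => [|n IH] A symA dA.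
  move=> + /(_ (fun=> 1)); rewrite det_lead0 /form !big_ord1 mul1r mulr1.
  by rewrite leNgt => ->.
have := dA 0%N isT; rewrite det_lead0 => a0.
rewrite det_leadS ?gt_eqF// pmulr_rlt0// => dn /psdS h.
apply: (IH (schur A)) dn _ => [|j jn|]; [exact: schur_sym| |exact: h].
by have := dA j.+1 jn; rewrite det_leadS ?gt_eqF// pmulr_rgt0.
Qed.

(** The pivots of indices 0 to [n - 1] are required to be positive and that of index [n]
    negative. *)
Fixpoint pivot_signs A n : Prop :=
  if n is n'.+1 then 0 < A 0%N 0%N /\ pivot_signs (schur A) n'
  else A 0%N 0%N < 0.

Lemma det_pivot_signs A n : pivot_signs A n ->
  (forall j, (j < n)%N -> 0 < \det (lead A j)) /\ \det (lead A n) < 0.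
Proof.
elim: n A => [|n IH] A /=; first by rewrite det_lead0.
move=> [a0 /IH[dpos dneg]]; split; last by rewrite det_leadS ?gt_eqF// pmulr_rlt0.
by case=> [|j] jn; rewrite ?det_lead0// det_leadS ?gt_eqF// mulr_gt0// dpos.
Qed.

End schur_complement.

Lemma possemidef_lead (R : realType) (A : nat -> nat -> R) n :
  (forall i j, A i j = A j i) -> possemidef (lead A n) <-> psd A n.
Proof.
move=> symA; have E (v : 'rV[R]_n.+1) (w : nat -> R) :
    (forall i : 'I_n.+1, v 0 i = w i) -> (v *m lead A n *m v^T) 0 0 = form A n w.
  move=> vw; rewrite mxE /form exchange_big; apply: eq_bigr => j _.
  rewrite !mxE mulr_suml; apply: eq_bigr => i _.
  by rewrite !mxE !vw.
split=> [[_ h] w|h].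
  by rewrite -(E (\row_i w i))// => i; rewrite mxE.
split; first by apply/matrixP => i j; rewrite !mxE symA.
by move=> v; rewrite (E v (fun i => v 0 (inord i)))// => i; rewrite inord_val.
Qed.

(** * Interval arithmetic *)

Section interval_algorithm.
Local Open Scope Z_scope.

(* With a precision of [k] bits, [(l, h)] stands for the interval
   [[l / 2^k, h / 2^k]]. *)
Definition itv : Type := Z * Z.

Definition itv_add (x y : itv) : itv := (x.1 + y.1, x.2 + y.2).

Definition itv_sub (x y : itv) : itv := (x.1 - y.2, x.2 - y.1).

(** Multiplication by [a / b] for positive [a] and [b]. The double negation turns the floor into a
    ceiling, so that both ends are rounded outwards. *)
Definition itv_scale (a b : Z) (x : itv) : itv := (x.1 * a / b, - (- x.2 * a / b)).

Variable k : Z.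

(** Products of endpoints carry the scale [2^(2k)]; the shift restores [2^k]. *)
Definition itv_mul (x y : itv) : itv :=
  let p := x.1 * y.1 in let q := x.1 * y.2 in
  let r := x.2 * y.1 in let s := x.2 * y.2 in
  (Z.shiftr (Z.min (Z.min p q) (Z.min r s)) k,
   - Z.shiftr (- Z.max (Z.max p q) (Z.max r s)) k).

(** A lower bound for a quotient by a positive interval: a nonnegative [a] is divided by the largest
    denominator, a negative one by the smallest. *)
Definition div_down (a : Z) (y : itv) : Z := a / (if 0 <=? a then y.2 else y.1).

Definition itv_div (x y : itv) : itv :=
  (div_down (Z.shiftl x.1 k) y, - div_down (Z.shiftl (- x.2) k) y).

(* Since the moments of the beta distribution satisfy
   [m n.+1 = (a + 10 n) / (b + 10 n) * m n] with integers [a] and [b], the sum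
   of the [m j.+1 * C_j] is evaluated as
   [r_0 * (C_0 + r_1 * (C_1 + ...))], where [r_n = (a + 10 n) / (b + 10 n)]. *)
Fixpoint horner (a b : Z) (C : seq itv) : itv :=
  if C is x :: C' then itv_scale a b (itv_add x (horner (a + 10) (b + 10) C'))
  else (0, 0).

Section cumulants.
Variables a b : Z.

(** The recursion for [g] solved for its term [j = 0]: from [x], standing for [g k.+1 s], and the
    known part of column [s.+1], it gets [g k s.+1]. *)
Definition next (x : itv) (Cs : seq (seq itv)) : itv :=
  itv_sub x (horner a b (head [::] Cs)).

(** Walks along an antidiagonal. Its last value opens a new column and is a free cumulant, as
    [g 0 s] is [kappa s]. *)
Fixpoint extend (x : itv) (Cs : seq (seq itv)) : seq (seq itv) :=
  if Cs is C :: Cs' then (x :: C) :: extend (next x Cs') Cs' else [:: [:: x]].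

(* The column of index [s] (from [1] on) lists [g k s] for decreasing [k], where
   [g] is the array of [moment_cumulant_triangle]; each step adds the
   antidiagonal that starts from the next moment. *)
Fixpoint columns (n : nat) (c d : Z) (x : itv) (Cs : seq (seq itv)) :=
  if n is n'.+1 then
    let y := itv_scale c d x in
    columns n' (c + 10) (d + 10) y (extend (next y Cs) Cs)
  else Cs.

(** The last entry of column [s] is [g 0 s]; the starting interval is the moment [m 0 = 1]. *)
Definition cumulants (n : nat) : seq itv :=
  map (last (0, 0)) (columns n a b (Z.shiftl 1 k, Z.shiftl 1 k) [::]).

End cumulants.

Fixpoint hankel_rows (w n : nat) (l : seq itv) : seq (seq itv) :=
  if n is n'.+1 then take w l :: hankel_rows w n' (behead l) else [::].

Fixpoint sub_row (c : itv) (row b : seq itv) : seq itv :=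
  match row, b with
  | d :: row', y :: b' => itv_sub d (itv_mul c y) :: sub_row c row' b'
  | _, _ => [::]
  end.

Fixpoint sub_rows (rows : seq (seq itv)) (b : seq itv) : seq (seq itv) :=
  if rows is row :: rows' then
    (if row is c :: d then sub_row c d b else [::]) :: sub_rows rows' b
  else [::].

(** Interval counterpart of [pivot_signs]; an empty matrix or an empty first row is rejected. *)
Fixpoint check_signs (n : nat) (M : seq (seq itv)) : bool :=
  if M is (x :: b) :: rows then
    if n is n'.+1 then
      (0 <? x.1) && check_signs n' (sub_rows rows (map (itv_div^~ x) b))
    else x.2 <? 0
  else false.

(** [behead] drops the first cumulant: the Hankel matrix starts at index 2 and ends at index
    [2 * N + 2]. *)
Definition check (a b : Z) (N : nat) : bool :=
  check_signs N (hankel_rows N.+1 N.+1 (behead (cumulants a b (2 * N + 2)))).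

End interval_algorithm.

Local Open Scope ring_scope.

(** * Soundness of the interval algorithm *)

Section soundness.
Variable R : realFieldType.

Definition zr (z : Z) : R := (int_of_Z z)%:~R.

Lemma zrD x y : zr (Z.add x y) = zr x + zr y.
Proof. by rewrite /zr -intrD; congr (_%:~R); lia. Qed.

Lemma zrM x y : zr (Z.mul x y) = zr x * zr y.
Proof. by rewrite /zr -intrM; congr (_%:~R); lia. Qed.

Lemma zrN x : zr (Z.opp x) = - zr x.
Proof. by rewrite /zr -mulrNz; congr (_%:~R); lia. Qed.

Lemma zrB x y : zr (Z.sub x y) = zr x - zr y.
Proof. by rewrite -zrN -zrD. Qed.

Lemma le_zr x y : (zr x <= zr y) = Z.leb x y.
Proof. rewrite /zr ler_int; lia. Qed.

Lemma lt_zr x y : (zr x < zr y) = Z.ltb x y.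
Proof. rewrite /zr ltr_int; lia. Qed.

Lemma zr0 : zr Z0 = 0. Proof. by []. Qed.

Lemma zr_gt0 x : (0 < zr x) = Z.ltb 0 x.
Proof. by rewrite -lt_zr. Qed.

Lemma zr_div_le a b : 0 < zr b -> zr (Z.div a b) <= zr a / zr b.
Proof.
move=> b0; rewrite ler_pdivlMr// -zrM le_zr.
by move: b0; rewrite zr_gt0 => /Z.ltb_lt /(Z.mul_div_le a); rewrite Z.mul_comm => /Z.leb_le.
Qed.

Variable k : Z.
Hypothesis k0 : Z.le 0 k.

Let S : R := zr (Z.pow 2 k).

Let S_gt0 : 0 < S.
Proof. by rewrite zr_gt0; lia. Qed.

Lemma zr_shiftl x : zr (Z.shiftl x k) = zr x * S.
Proof. by rewrite Z.shiftl_mul_pow2// zrM. Qed.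

Lemma zr_shiftr_le x : zr (Z.shiftr x k) <= zr x / S.
Proof. by rewrite Z.shiftr_div_pow2// zr_div_le. Qed.

Definition encl (x : itv) (r : R) : Prop := zr x.1 <= r * S <= zr x.2.

Lemma encl_add x y r s : encl x r -> encl y s -> encl (itv_add x y) (r + s).
Proof.
move=> /andP[x1 x2] /andP[y1 y2].
by rewrite /encl/= !zrD mulrDl !lerD.
Qed.

Lemma encl_sub x y r s : encl x r -> encl y s -> encl (itv_sub x y) (r - s).
Proof.
move=> /andP[x1 x2] /andP[y1 y2].
by rewrite /encl/= !zrB mulrBl !lerB.
Qed.

Lemma encl_scale a b x r : 0 < zr a -> 0 < zr b -> encl x r ->
  encl (itv_scale a b x) (zr a / zr b * r).
Proof.
move=> a0 b0 /andP[x1 x2].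
have e : zr a / zr b * r * S = r * S * zr a / zr b by ring.
rewrite /encl/= zrN lerNr e; apply/andP; split; apply: (le_trans (zr_div_le _ b0)).
  by rewrite ler_pM2r ?invr_gt0// zrM ler_pM2r.
by rewrite -!mulNr ler_pM2r ?invr_gt0// zrM zrN ler_pM2r// mulNr lerN2.
Qed.

Lemma zr_min x y : zr (Z.min x y) = Num.min (zr x) (zr y).
Proof.
case: (Z.min_spec x y) => -[xy ->]; apply/esym.
  by apply/min_idPl; rewrite le_zr; lia.
by apply/min_idPr; rewrite le_zr; lia.
Qed.

Lemma zr_max x y : zr (Z.max x y) = Num.max (zr x) (zr y).
Proof.
case: (Z.max_spec x y) => -[xy ->]; apply/esym.
  by apply/max_idPr; rewrite le_zr; lia.
by apply/max_idPl; rewrite le_zr; lia.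
Qed.

Let mul_bounds (a b t u : R) : a <= t <= b ->
  Num.min (a * u) (b * u) <= t * u <= Num.max (a * u) (b * u).
Proof.
move=> /andP[at_ tb]; rewrite ge_min le_max.
case: (leP 0 u) => [u0|/ltW u0].
  by rewrite (ler_wpM2r u0 at_) (ler_wpM2r u0 tb) orbT.
by rewrite (ler_wnM2r u0 at_) (ler_wnM2r u0 tb) orbT.
Qed.

(** A product is monotone or antitone in each factor, so its extremes are at the four corners:
    [mul_bounds] is applied to the first factor, then to the second at both ends of the first. *)
Lemma encl_mul x y r s : encl x r -> encl y s -> encl (itv_mul k x y) (r * s).
Proof.
case: x y => [a b] [c d] rx /andP[/= sc sd].
have e : r * s * S = (r * S) * (s * S) / S by field; rewrite gt_eqF.
have /andP[h1 h2] := mul_bounds (s * S) rx.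
have /andP[a1 a2] : Num.min (zr a * zr c) (zr a * zr d) <= zr a * (s * S) <=
    Num.max (zr a * zr c) (zr a * zr d).
  by rewrite ![zr a * _]mulrC mul_bounds// sc.
have /andP[b1 b2] : Num.min (zr b * zr c) (zr b * zr d) <= zr b * (s * S) <=
    Num.max (zr b * zr c) (zr b * zr d).
  by rewrite ![zr b * _]mulrC mul_bounds// sc.
rewrite /encl/= zrN lerNr e; apply/andP; split; apply: (le_trans (zr_shiftr_le _)).
  rewrite ler_pM2r ?invr_gt0// !zr_min !zrM (le_trans _ h1)//.
  by rewrite le_min ge_min a1 /= ge_min b1 orbT.
rewrite -mulNr ler_pM2r ?invr_gt0// zrN lerN2 !zr_max !zrM (le_trans h2)//.
by rewrite ge_max le_max a2 /= le_max b2 orbT.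
Qed.

Lemma div_down_le a y s t : 0 < zr y.1 -> zr y.1 <= s <= zr y.2 -> zr a <= t ->
  zr (div_down a y) <= t / s.
Proof.
move=> y0 /andP[y1 y2] at_; have s0 := lt_le_trans y0 y1.
apply: (@le_trans _ _ (zr a / s)); last by rewrite ler_pM2r ?invr_gt0.
rewrite /div_down -le_zr zr0; case: ifPn => [a0|].
  apply: (le_trans (zr_div_le _ (lt_le_trans s0 y2))).
  by rewrite ler_wpM2l// lef_pV2 ?posrE// (lt_le_trans s0).
rewrite -ltNge => /ltW a0; apply: (le_trans (zr_div_le _ y0)).
by rewrite ler_wnM2l// lef_pV2 ?posrE.
Qed.

Lemma encl_div x y r s : 0 < zr y.1 -> encl x r -> encl y s ->
  encl (itv_div k x y) (r / s).
Proof.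
move=> y0 /andP[x1 x2] ys; have /andP[y1 y2] := ys.
have s0 : s != 0.
  by apply: contraTneq (lt_le_trans y0 y1) => ->; rewrite mul0r ltxx.
have e : r / s * S = r * S * S / (s * S) by field; rewrite s0 gt_eqF.
rewrite /encl/= zrN lerNr e -mulNr !div_down_le//.
  by rewrite zr_shiftl zrN -!mulNr ler_pM2r// mulNr lerN2.
by rewrite zr_shiftl ler_pM2r.
Qed.

Section columns.
Variables (a b : Z) (m : nat -> R) (g : nat -> nat -> R).
Hypotheses (a0 : Z.lt 0 a) (b0 : Z.lt 0 b).
Let num (c : Z) (t : nat) : Z := Z.add c (Z.mul 10 (Z.of_nat t)).
Hypotheses (m0 : m 0 = 1)
  (mS : forall t, m t.+1 = zr (num a t) / zr (num b t) * m t)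
  (gS : forall i s, g i.+1 s = \sum_(j < i.+1) m j * g (i - j) s.+1)
  (gm : forall i, (0 < i)%N -> m i = g i 0).

Let num_gt0 c t : Z.lt 0 c -> 0 < zr (num c t).
Proof. by rewrite zr_gt0 /num; lia. Qed.

Let numS c t : Z.add (num c t) 10 = num c t.+1.
Proof. by rewrite /num; lia. Qed.

Let m_neq0 t : m t != 0.
Proof.
elim: t => [|t IH]; first by rewrite m0 oner_eq0.
by rewrite mS !mulf_neq0// ?invr_neq0// gt_eqF// num_gt0.
Qed.

Fixpoint encl_col s (C : seq itv) : Prop :=
  if C is x :: C' then encl x (g (size C') s) /\ encl_col s C' else True.

(** The nested ratios telescope: those of indices [t] to [t + i] multiply to [m (t + i.+1) / m t],
    hence the division by [m t]. *)
Lemma encl_horner s C : encl_col s C -> forall t,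
  encl (horner (num a t) (num b t) C)
    ((\sum_(i < size C) m (t + i.+1) * g (size C - i.+1) s) / m t).
Proof.
elim: C => [_ t|x C IH /= [xg /IH h] t].
  by rewrite big_ord0 mul0r /encl/= mul0r lexx.
rewrite !numS; have := encl_scale (num_gt0 t a0) (num_gt0 t b0) (encl_add xg (h t.+1)).
congr encl; rewrite big_ord_recl /= addn1 subn1 /= mulrDr mulrDl; congr (_ + _).
  by rewrite mS; field; rewrite m_neq0 gt_eqF ?num_gt0.
under [in RHS]eq_bigr => i _ do rewrite /bump /= add1n subSS -addSnnS.
by rewrite mS; field; rewrite m_neq0 !gt_eqF ?num_gt0.
Qed.

(** The columns form a staircase: each is as long as the number of columns from it on. *)
Fixpoint encl_cols s (Cs : seq (seq itv)) : Prop :=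
  if Cs is C :: Cs' then
    [/\ size C = size Cs, encl_col s C & encl_cols s.+1 Cs'] else True.

Lemma encl_next x s Cs : encl_cols s.+1 Cs -> encl x (g (size Cs).+1 s) ->
  encl (next a b x Cs) (g (size Cs) s.+1).
Proof.
move=> hC hx; rewrite /next.
have -> : g (size Cs) s.+1 = g (size Cs).+1 s -
    (\sum_(i < size Cs) m (0 + i.+1) * g (size Cs - i.+1) s.+1) / m 0.
  rewrite gS big_ord_recl subn0 m0 mul1r divr1 addrAC -addrA -[LHS]addr0.
  by congr (_ + _); rewrite addrC subrr.
apply: encl_sub => //; have := encl_horner (s := s.+1) (C := head [::] Cs).
have -> : size (head [::] Cs) = size Cs by case: Cs hC {hx} => //= C Cs [].
move=> /(_ _ 0%N); rewrite /num !Z.add_0_r; apply.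
by case: Cs hC {hx} => //= C Cs [].
Qed.

Lemma encl_extend x s Cs : encl_cols s Cs -> encl x (g (size Cs) s) ->
  encl_cols s (extend a b x Cs) /\ size (extend a b x Cs) = (size Cs).+1.
Proof.
elim: Cs s x => [|C Cs IH] s x /=; first by [].
move=> [sC hC hCs] hx.
have [h1 h2] := IH _ _ hCs (encl_next hCs hx).
by split; rewrite ?h2//; split=> //=; rewrite ?h2 ?sC.
Qed.

Lemma encl_columns n t x Cs : encl_cols 1 Cs -> size Cs = t -> encl x (m t) ->
  encl_cols 1 (columns a b n (num a t) (num b t) x Cs) /\
  size (columns a b n (num a t) (num b t) x Cs) = (t + n)%N.
Proof.
elim: n t x Cs => [|n IH] t x Cs hCs sCs hx /=; first by rewrite addn0.
have hy : encl (itv_scale (num a t) (num b t) x) (m t.+1).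
  by rewrite mS; apply: encl_scale => //; exact: num_gt0.
have hz : encl (next a b (itv_scale (num a t) (num b t) x) Cs) (g (size Cs) 1).
  by apply: encl_next => //; rewrite sCs -gm.
have [h1 h2] := encl_extend hCs hz.
by rewrite !numS addnS -addSn; apply: IH; rewrite ?h2 ?sCs.
Qed.

Fixpoint encl_row (f : nat -> R) (l : seq itv) : Prop :=
  if l is x :: l' then encl x (f 0%N) /\ encl_row (f \o succn) l' else True.

Lemma encl_last s Cs : encl_cols s Cs ->
  encl_row (fun i => g 0 (s + i)%N) (map (last (Z0, Z0)) Cs).
Proof.
elim: Cs s => //= C Cs IH s [sC hC /IH h]; split; last first.
  rewrite (_ : _ \o _ = fun i => g 0 (s.+1 + i)%N)//.
  by apply/boolp.funext => i /=; rewrite addnS.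
rewrite addn0; case: C sC hC => // x C _ [].
elim: C x => //= y C IHC x _ [hy hC]; exact: IHC.
Qed.

Lemma encl_cumulants n : encl_row (fun i => g 0 i.+1) (cumulants k a b n).
Proof.
have := @encl_columns n 0 (Z.shiftl 1 k, Z.shiftl 1 k) [::] I erefl.
rewrite /num !Z.add_0_r m0 => -[|h _]; last exact: encl_last h.
by rewrite /encl /= zr_shiftl lexx.
Qed.

End columns.

Lemma encl_row_take n f l : encl_row f l -> encl_row f (take n l).
Proof. by elim: l n f => [|x l IH] [|n] f //= [hx /IH]; split. Qed.

Fixpoint encl_mat (A : nat -> nat -> R) (M : seq (seq itv)) : Prop :=
  if M is l :: M' then encl_row (A 0%N) l /\ encl_mat (A \o succn) M' else True.

Lemma encl_hankel_rows w n f l : encl_row f l ->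
  encl_mat (fun i j => f (i + j)%N) (hankel_rows w n l).
Proof.
elim: n f l => //= n IH f l hl; split; first exact: encl_row_take.
rewrite (_ : _ \o _ = fun i j => (f \o succn) (i + j)%N)//.
by apply: IH; case: l hl => //= x l [].
Qed.

Lemma encl_sub_row c r f h row b : encl c r -> encl_row f row -> encl_row h b ->
  encl_row (fun j => f j - r * h j) (sub_row k c row b).
Proof.
move=> cr; elim: row f h b => [|x row IH] f h [|y b] //= [hx hrow] [hy hb].
by split; [exact/encl_sub/encl_mul | exact: (IH (f \o succn) (h \o succn))].
Qed.

Lemma encl_sub_rows A h rows b : encl_mat A rows -> encl_row h b ->
  encl_mat (fun i j => A i j.+1 - A i 0%N * h j) (sub_rows k rows b).
Proof.
elim: rows A => [//|row rows IH] A [hrow hrows] hb; split; last first.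
  exact: (IH (A \o succn)).
case: row hrow => //= c d [hc hd].
exact: (encl_sub_row (f := A 0%N \o succn) hc hd hb).
Qed.

Lemma encl_row_map_div x r f l : 0 < zr x.1 -> encl x r -> encl_row f l ->
  encl_row (fun j => f j / r) (map ((itv_div k)^~ x) l).
Proof.
move=> x0 hx; elim: l f => //= y l IH f [hy hl].
by split; [exact: encl_div | exact: (IH (f \o succn))].
Qed.

Lemma check_signsP n A M : encl_mat A M -> check_signs k n M -> pivot_signs A n.
Proof.
elim: n A M => [|n IH] A [//|[//|x b] rows] /= [[hx hb] hrows]; last first.
  move=> /andP[x0 hn]; rewrite -zr_gt0 in x0; split.
    case/andP: hx => hx _.
    by have := lt_le_trans x0 hx; rewrite pmulr_lgt0.
  apply: IH hn.
  exact: (encl_sub_rows hrows (encl_row_map_div x0 hx hb)).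
rewrite -lt_zr => x0; case/andP: hx => _ hx.
by have := le_lt_trans hx x0; rewrite pmulr_llt0.
Qed.

Lemma checkP a b N (m : nat -> R) (g : nat -> nat -> R) :
  Z.lt 0 a -> Z.lt 0 b -> m 0%N = 1 ->
  (forall t, m t.+1 = zr (Z.add a (Z.mul 10 (Z.of_nat t))) /
                      zr (Z.add b (Z.mul 10 (Z.of_nat t))) * m t) ->
  (forall i s, g i.+1 s = \sum_(j < i.+1) m j * g (i - j)%N s.+1) ->
  (forall i, (0 < i)%N -> m i = g i 0%N) ->
  check k a b N -> pivot_signs (fun i j => g 0%N (i + j).+2) N.
Proof.
move=> a0 b0 m0 mS gS gm; apply: check_signsP; apply: (@encl_hankel_rows _ _ (fun i => g 0%N i.+2)).
have := encl_cumulants a0 b0 m0 mS gS gm (2 * N + 2).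
by case: cumulants => //= x l [].
Qed.

End soundness.

From mathcomp Require Import all_classical all_reals all_analysis.
From mathcomp Require Import measurable_realfun.

Import numFieldNormedType.Exports.

Local Open Scope classical_set_scope.
Local Open Scope ring_scope.

(** * Moments of the beta distribution *)

Section beta_moments.
Context {R : realType}.
Implicit Types p q x a : R.
Local Notation mu := (@lebesgue_measure R).

Definition beta_kernel p q x : R := x `^ (p - 1) * (1 - x) `^ (q - 1).

Definition beta_integral p q : \bar R :=
  (\int[mu]_(x in `]0%R, 1%R[) (beta_kernel p q x)%:E)%E.

Lemma beta_kernel_ge0 p q x : 0 <= beta_kernel p q x.
Proof. by rewrite mulr_ge0 ?powR_ge0. Qed.

Lemma measurable_beta_kernel p q : measurable_fun setT (beta_kernel p q).
Proof.
apply: measurable_funM; first exact: measurable_powR.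
apply: (@measurableT_comp _ _ _ _ _ _ (@powR R ^~ (q - 1))).
  exact: measurable_powR.
exact: measurable_funB.
Qed.

(** Writing one factor of [(1 - x) ^ q] as [1 - x] leaves kernels with the same [q] only, so that
    integration gives a recursion in [p]. *)
Lemma is_derive_beta_prim p q x : 0 < x < 1 ->
  is_derive x 1 (fun x => x `^ p * (1 - x) `^ q)
    (p * beta_kernel p q x - (p + q) * beta_kernel (p + 1) q x).
Proof.
move=> /andP[x0 x1].
have y0 : 0 < 1 - x by rewrite subr_gt0.
have d1 : is_derive x 1 (fun x => 1 - x) (-1 : R).
  have := is_deriveB (is_derive_cst (1 : R) x 1) (is_derive_id x 1).
  by rewrite sub0r.
have d2 := is_derive1_comp (f := @powR R ^~ q) (g := fun x => 1 - x) (is_derive1_powR q y0) d1.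
have := is_deriveM (is_derive1_powR p x0) d2.
move=> /is_derive_eq; apply; rewrite /beta_kernel /= addrK.
have e (y r : R) : 0 < y -> y `^ r = y `^ (r - 1) * y.
  by move=> y_gt0; rewrite powRB ?(gt_eqF y_gt0) ?implybT// powRr1 ?ltW// divfK ?gt_eqF.
rewrite (e x p)// (e (1 - x) q)// /GRing.scale /=; ring.
Qed.

(** The segments [[a_ n, 1 - a_ n]] exhaust the open unit interval and avoid the ends, where the
    kernel may be singular; starting at 1/3 keeps them nondegenerate. *)
Let a_ n : R := n.+3%:R^-1.

Let a_gt0 n : 0 < a_ n. Proof. by rewrite invr_gt0. Qed.

Let a_lt n : a_ n < 1 - a_ n.
Proof.
rewrite ltrBrDr -mulr2n -mulr_natr ltr_pdivrMl ?ltr0n// mulr1 ltr_nat //.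
Qed.

Let a_in n x : x \in `[a_ n, 1 - a_ n] -> 0 < x < 1.
Proof.
rewrite in_itv/= => /andP[ax xa]; rewrite (lt_le_trans _ ax)//=.
by rewrite (le_lt_trans xa)// gtrBl.
Qed.

Let is_derive_kernel p q x : 0 < x < 1 -> derivable (beta_kernel p q) x 1.
Proof.
move=> x01; have := is_derive_beta_prim (p - 1) (q - 1) x01.
by case.
Qed.

Let continuous_kernel p q n : {within `[a_ n, 1 - a_ n], continuous (beta_kernel p q)}.
Proof.
by apply: derivable_within_continuous => x /a_in; exact: is_derive_kernel.
Qed.

Let integrable_kernel p q n :
  mu.-integrable `[a_ n, 1 - a_ n] (EFin \o beta_kernel p q).
Proof.
by apply: continuous_compact_integrable; [exact: segment_compact|exact: continuous_kernel].
Qed.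

Let In p q n : R := \int[mu]_(x in `[a_ n, 1 - a_ n]) beta_kernel p q x.

(** The fundamental theorem of calculus on a segment, with the boundary terms kept. *)
Let In_rec p q n : p * In p q n = (p + q) * In (p + 1) q n +
  ((1 - a_ n) `^ p * (a_ n) `^ q - (a_ n) `^ p * (1 - a_ n) `^ q).
Proof.
set F := fun x => x `^ p * (1 - x) `^ q.
set f := fun x => p * beta_kernel p q x - (p + q) * beta_kernel (p + 1) q x.
have dF x : 0 < x < 1 -> is_derive x 1 F (f x) by exact: is_derive_beta_prim.
have cF : {within `[a_ n, 1 - a_ n], continuous F}.
  by apply: derivable_within_continuous => x /a_in /dF h; exact: ex_derive.
have cf : {within `[a_ n, 1 - a_ n], continuous f}.
  apply: derivable_within_continuous => x /a_in x01.
  by apply: derivableB; apply: derivableM => //; exact: is_derive_kernel.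
have bF : derivable_oo_LRcontinuous F (a_ n) (1 - a_ n).
  have [_ Fa Fb] := (continuous_within_itvP _ (a_lt n)).1 cF.
  split => // x xab; apply: ex_derive; apply: dF.
  by apply: (@a_in n); exact: subset_itv_oo_cc xab.
have F'f : {in `](a_ n), (1 - a_ n)[, F^`()%classic =1 f}.
  move=> x xab; rewrite derive1E; apply: derive_val; apply: dF.
  by apply: (@a_in n); exact: subset_itv_oo_cc xab.
have /(congr1 fine) := continuous_FTC2 (a_lt n) cf bF F'f.
rewrite -[LHS]/(Rintegral _ _ _) -EFinB /= RintegralB//; last 2 first.
  apply: (integrableZl _ p (integrable_kernel _ _ _)) => //.
  exact: (integrableZl _ (p + q) (integrable_kernel _ _ _)).
rewrite (RintegralZl p _ (integrable_kernel p q n))//.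
rewrite (RintegralZl (p + q) _ (integrable_kernel (p + 1) q n))//.
rewrite /F -/(In p q n) -/(In (p + 1) q n) => /eqP.
by rewrite subr_eq opprB subrKC => /eqP ->; rewrite addrC.
Qed.

Let a_cvg0 : a_ n @[n --> \oo] --> (0 : R).
Proof. by have := @cvg_harmonic R; rewrite -cvg_shiftS -cvg_shiftS. Qed.

Let a_powR_cvg0 p : 0 < p -> (a_ n) `^ p @[n --> \oo] --> (0 : R).
Proof. by move=> /powR_cvg0/cvg_at_rightP; apply; split. Qed.

Let powR_le1 x p : 0 < x <= 1 -> 0 <= p -> x `^ p <= 1.
Proof. by move=> x01 p0; rewrite -(powRr0 x); exact: ger_powR. Qed.

Let edge_cvg0 p q : 0 < p -> 0 < q ->
  ((1 - a_ n) `^ p * (a_ n) `^ q - (a_ n) `^ p * (1 - a_ n) `^ q) @[n --> \oo]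
  --> (0 : R).
Proof.
move=> p0 q0; rewrite -[0 in X in _ --> X]subr0.
have b01 n : 0 < 1 - a_ n <= 1.
  by rewrite (lt_trans (a_gt0 n) (a_lt n)) gerBl ltW.
apply: cvgB; apply: squeeze_cvgr; [|exact: cvg_cst|exact: (a_powR_cvg0 q0)
  |  |exact: cvg_cst|exact: (a_powR_cvg0 p0)].
- near=> n; rewrite mulr_ge0 ?powR_ge0//= ler_piMl ?powR_ge0//.
  exact: powR_le1 (b01 n) (ltW p0).
- near=> n; rewrite mulr_ge0 ?powR_ge0//= ler_piMr ?powR_ge0//.
  exact: powR_le1 (b01 n) (ltW q0).
Unshelve. all: by end_near. Qed.

Let bigcup_a : \bigcup_n `[a_ n, 1 - a_ n]%classic = `]0%R, 1%R[%classic :> set R.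
Proof.
apply/seteqP; split => [x [n _] /a_in|x]; rewrite /= in_itv //=.
move=> /andP[x0 x1].
have m0 : 0 < Num.min x (1 - x) by rewrite lt_min x0 subr_gt0.
have [n _ /(_ n (leqnn n))] := cvgr_lt _ a_cvg0 _ m0.
rewrite lt_min => /andP[/ltW h1 /ltW h2]; exists n => //=.
by rewrite in_itv/= h1 lerBrDr addrC -lerBrDr.
Qed.

Let In_cvg p q : (In p q n)%:E @[n --> \oo] --> beta_integral p q.
Proof.
rewrite /beta_integral -bigcup_a.
have -> : (fun n => (In p q n)%:E) = (fun n =>
    \int[mu]_(x in `[a_ n, (1 - a_ n)%R]) (beta_kernel p q x)%:E)%E.
  apply/funext => n; rewrite /In fineK//.
  exact: integrable_fin_num (integrable_kernel p q n).
apply: ge0_nondecreasing_set_cvg_integral => //.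
- move=> m n mn; apply/subsetPset => x /=; rewrite !in_itv/= => /andP[h1 h2].
  have am : a_ n <= a_ m by rewrite lef_pV2 ?posrE// ler_nat.
  by rewrite (le_trans am h1) (le_trans h2)// lerB.
- by move=> n; apply/measurable_EFinP; apply: measurable_funTS; exact: measurable_beta_kernel.
- by move=> n x _; rewrite lee_fin beta_kernel_ge0.
Qed.

(** The limit of [In_rec], whose boundary terms vanish. Finiteness is assumed at [p + 1] only and is
    transferred to [p]. *)
Lemma beta_integral_rec p q b : 0 < p -> 0 < q ->
  beta_integral (p + 1) q = b%:E -> beta_integral p q = ((p + q) / p * b)%:E.
Proof.
move=> p0 q0 hb; rewrite -(cvg_lim _ (@In_cvg p q))//; apply/cvg_lim => //.
apply: cvg_EFin; first exact: nearW.
have h : In (p + 1) q n @[n --> \oo] --> b.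
  by have := @In_cvg (p + 1) q; rewrite hb => /fine_cvg.
have -> : (fine \o (fun n => (In p q n)%:E)) = (fun n => (p + q) / p * In (p + 1) q n +
  p^-1 * ((1 - a_ n) `^ p * (a_ n) `^ q - (a_ n) `^ p * (1 - a_ n) `^ q)).
  apply/funext => n /=; rewrite -[LHS](mulKf (lt0r_neq0 p0)) In_rec mulrDr.
  by rewrite mulrA (mulrC p^-1 (p + q)).
rewrite -[X in _ --> X]addr0 -[0 in X in _ --> X](mulr0 p^-1).
by apply: cvgD; apply: cvgMr; [|exact: edge_cvg0].
Qed.

(** For [q >= 1] the kernel of parameter [p + 1] is at most 1, hence has a finite integral; the
    recursion brings this down to [p]. *)
Lemma beta_integralE p q : 0 < p -> 1 <= q ->
  beta_integral p q = (euler_beta p q)%:E.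
Proof.
move=> p0 q1.
suff [b hb] : exists b, beta_integral p q = b%:E.
  by rewrite hb /euler_beta /Rintegral -[X in fine X]/(beta_integral p q) hb.
have [b hb] : exists b, beta_integral (p + 1) q = b%:E.
  exists (fine (beta_integral (p + 1) q)); rewrite fineK// ge0_fin_numE; last first.
    by apply: integral_ge0 => x _; rewrite lee_fin beta_kernel_ge0.
  apply: (@le_lt_trans _ _ (\int[mu]_(x in `]0%R, 1%R[) (cst 1%E x))%E).
    apply: ge0_le_integral => //=.
    - by move=> x _; rewrite lee_fin beta_kernel_ge0.
    - apply/measurable_EFinP; apply: measurable_funTS; exact: measurable_beta_kernel.
    - move=> x; rewrite in_itv/= => /andP[x0 x1]; rewrite lee_fin.
      rewrite mulr_ile1 ?powR_ge0// powR_le1 ?x0 ?(ltW x1) ?addrK ?(ltW p0)//.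
      by rewrite subr_gt0 x1 gerBl ltW.
      by rewrite subr_ge0.
  by rewrite integral_cst//= lebesgue_measure_itv/= lte01 mul1e oppr0 adde0 ltry.
exists ((p + q) / p * b); apply: beta_integral_rec => //.
exact: lt_le_trans q1.
Qed.

Lemma euler_beta_rec p q : 0 < p -> 1 <= q ->
  euler_beta (p + 1) q = p / (p + q) * euler_beta p q.
Proof.
move=> p0 q1; have q0 : 0 < q by exact: lt_le_trans q1.
have := beta_integral_rec p0 q0 (beta_integralE (addr_gt0 p0 ltr01) q1).
rewrite beta_integralE// => -[->].
rewrite mulrA [X in X * _](_ : _ = 1) ?mul1r//.
by field; rewrite !gt_eqF ?addr_gt0.
Qed.

Lemma euler_beta_gt0 p q : 0 < p -> 1 <= q -> 0 < euler_beta p q.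
Proof.
move=> p0 q1; rewrite -lte_fin -beta_integralE//.
(* A lower bound of the kernel on [[1/4, 1/2]]. The exponent [p] instead of [p - 1] spares a
   discussion of signs, as [x ^ (p - 1) >= x ^ p] there. *)
pose c : R := 4^-1 `^ p * 2^-1 `^ (q - 1).
have c0 : 0 < c by rewrite mulr_gt0// powR_gt0.
apply: (@lt_le_trans _ _ (\int[mu]_(x in `[(4^-1)%R, (2^-1)%R]) (c%:E))%E).
  rewrite integral_cst//= lebesgue_measure_itv/= lte_fin ifT; last by lra.
  by rewrite -EFinB -EFinM lte_fin mulr_gt0// subr_gt0; lra.
apply: (@le_trans _ _ (\int[mu]_(x in `[(4^-1)%R, (2^-1)%R]) (beta_kernel p q x)%:E)%E).
  apply: ge0_le_integral => //=.
  - by move=> x _; rewrite lee_fin ltW.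
  - apply/measurable_EFinP; apply: measurable_funTS; exact: measurable_beta_kernel.
  - move=> x; rewrite in_itv/= => /andP[x4 x2]; rewrite lee_fin.
    have x0 : 0 < x by lra.
    apply: ler_pM; rewrite ?powR_ge0//.
      apply: (@le_trans _ _ (x `^ p)); first by rewrite ge0_ler_powR ?nnegrE//; lra.
      by apply: ger_powR; [lra | rewrite gerBl].
    by rewrite ge0_ler_powR ?nnegrE//; lra.
apply: ge0_subset_integral => //=.
- apply/measurable_EFinP; apply: measurable_funTS; exact: measurable_beta_kernel.
- by move=> x _; rewrite lee_fin beta_kernel_ge0.
- by move=> x /=; rewrite !in_itv/= => /andP[? ?]; apply/andP; split; lra.
Qed.

End beta_moments.

(** * Integration against a measure with a density *)

Section density.
Local Open Scope ereal_scope.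
Import HBNNSimple.

(** Monotone convergence reduces the claim to simple functions, and linearity to indicators, where
    it is the hypothesis on [nu]. *)
Lemma ge0_integral_density d (T : measurableType d) (R : realType)
    (mu nu : {measure set T -> \bar R}) (g : T -> R) (f : T -> \bar R) :
  measurable_fun setT g -> (forall x, (0 <= g x)%R) ->
  (forall A, measurable A -> nu A = \int[mu]_(x in A) (g x)%:E) ->
  measurable_fun setT f -> (forall x, 0 <= f x) ->
  \int[nu]_x f x = \int[mu]_x (f x * (g x)%:E).
Proof.
move=> mg g0 nuE mf f0.
pose h := nnsfun_approx measurableT mf.
have ndh x : {homo (fun n => (h n x)%:E) : m n / (m <= n)%N >-> m <= n}.
  by move=> m n mn; rewrite lee_fin; exact/lefP/nd_nnsfun_approx.
have fE x : f x = limn (fun n => (h n x)%:E).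
  by apply/esym/cvg_lim => //; exact: cvg_nnsfun_approx.
have fgE x : f x * (g x)%:E = limn (fun n => (h n x)%:E * (g x)%:E).
  by apply/esym/cvg_lim => //; apply: cvgeZr => //; exact: cvg_nnsfun_approx.
under eq_integral do rewrite fE.
under [RHS]eq_integral do rewrite fgE.
rewrite monotone_convergence//; last 2 first.
- by move=> n; exact/measurable_EFinP.
- by move=> n x _; rewrite lee_fin.
rewrite monotone_convergence//; last 3 first.
- by move=> n; apply: emeasurable_funM; exact/measurable_EFinP.
- by move=> n x _; rewrite mule_ge0 ?lee_fin.
- by move=> x _ m n mn; rewrite lee_wpmul2r ?lee_fin//; exact/lefP/nd_nnsfun_approx.
congr (limn _); apply/funext => n.
rewrite integralT_nnsfun sintegralE.
under [RHS]eq_integral => x _.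
  rewrite fimfunE -fsumEFin// ge0_mule_fsuml; last first.
    by move=> y; exact: nnfun_muleindic_ge0.
  over.
rewrite ge0_integral_fsum//; last 2 first.
- move=> y; apply: emeasurable_funM; last exact/measurable_EFinP.
  by apply/measurable_EFinP; exact: measurable_funM.
- by move=> y x _; apply: mule_ge0; [exact: nnfun_muleindic_ge0|rewrite lee_fin].
apply: eq_fsbigr => r rhn.
under [RHS]eq_integral do rewrite EFinM -muleA.
rewrite ge0_integralZl//; last 3 first.
- by apply: emeasurable_funM; exact/measurable_EFinP.
- by move=> x _; rewrite mule_ge0 ?lee_fin.
- by move: rhn; rewrite inE => -[t _ <-]; rewrite lee_fin.
rewrite nuE//; congr (_ * _).
rewrite integral_mkcond epatch_indic; apply: eq_integral => x _.
by rewrite /= muleC.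
Qed.

End density.

Section moments.
Context {R : realType}.
Implicit Types p q x : R.
Local Notation mu := (@lebesgue_measure R).

Lemma moment_betarE p q n : 0 < p -> 1 <= q ->
  moment (betar p q) n = euler_beta (p + n%:R) q / euler_beta p q.
Proof.
move=> p0 q1; rewrite /moment /Rintegral.
have B0 := euler_beta_gt0 p0 q1.
(* The measure vanishes off the open unit interval, so [x] may be replaced by its absolute value,
   which makes the integrand nonnegative everywhere. *)
have -> : (\int[betar p q]_x (x ^+ n)%:E = \int[betar p q]_x (`|x| ^+ n)%:E)%E.
  apply: ae_eq_integral => //.
  - by apply/measurable_EFinP; exact: exprn_measurable.
  - by apply/measurable_EFinP; apply: measurable_funX; exact: normr_measurable.
  exists (~` `]0, 1[); split.
  - exact: measurableC.
  - apply: integral0_eq => x x01; rewrite /betar_pdf patchE.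
    by rewrite memNset.
  - move=> x /= h x01; apply: h => _; move: x01; rewrite in_itv/= => /andP[x0 _].
    by rewrite gtr0_norm.
have mid : @measurable_fun _ _ R (measurableTypeR R) setT id.
  by move=> _ A mA; rewrite setTI.
have mabs : measurable_fun setT (fun x : measurableTypeR R => (`|x| ^+ n)%:E).
  by apply/measurable_EFinP; apply: measurable_funX; exact: normr_measurable.
have -> : (\int[betar p q]_x (`|x| ^+ n)%:E =
    \int[mu]_x ((`|x| ^+ n)%:E * (betar_pdf p q x)%:E))%E.
  (* Pushing forward along the identity only changes the measurable structure attached to the reals,
     before the density lemma is applied. *)
  pose phi : {mfun R >-> measurableTypeR R} := @mfun_Sub _ _ R (measurableTypeR R) id (mem_set mid).
  transitivity (\int[pushforward (betar p q) phi]_x (`|x| ^+ n)%:E)%E.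
    by rewrite ge0_integral_pushforward// => x _; rewrite lee_fin exprn_ge0.
  apply: ge0_integral_density => //.
  - exact: measurable_betar_pdf.
  - exact: betar_pdf_ge0.
transitivity (fine (\int[mu]_(x in `]0%R, 1%R[) ((beta_kernel (p + n%:R) q x)%:E *
    ((euler_beta p q)^-1)%:E))%E).
  congr fine; rewrite [RHS]integral_mkcond; apply: eq_integral => x _.
  rewrite /betar_pdf !patchE; case: ifPn; last by rewrite mule0.
  rewrite inE/= in_itv/= => /andP[x0 x1].
  rewrite -!EFinM gtr0_norm// /beta_kernel !mulrA; congr (_ * _ * _)%:E.
  rewrite -powR_mulrn ?ltW// -powRD; last by rewrite (gt_eqF x0) implybT.
  by rewrite addrCA addrA.
rewrite ge0_integralZr//; last 3 first.
- apply/measurable_EFinP; apply: measurable_funTS; exact: measurable_beta_kernel.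
- by move=> x _; rewrite lee_fin beta_kernel_ge0.
- by rewrite lee_fin invr_ge0 ltW.
by rewrite -/(beta_integral _ _) beta_integralE// ltr_wpDr.
Qed.

Lemma moment_betar0 p q : 0 < p -> 1 <= q -> moment (betar p q) 0 = 1.
Proof.
by move=> p0 q1; rewrite moment_betarE// addr0 divff// gt_eqF// euler_beta_gt0.
Qed.

Lemma moment_betarS p q n : 0 < p -> 1 <= q ->
  moment (betar p q) n.+1 =
  (p + n%:R) / (p + q + n%:R) * moment (betar p q) n.
Proof.
move=> p0 q1; rewrite !moment_betarE// -natr1 addrA euler_beta_rec//.
  by rewrite mulrA addrAC.
by rewrite ltr_wpDr.
Qed.

End moments.

(** * Continuity of the free cumulants and the theorem *)

(** By the Leibniz formula the determinant is a polynomial in the entries. *)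
Lemma cvg_det (R : realType) T (F : set_system T) (FF : Filter F) n
    (M : T -> 'M[R]_n) (A : 'M[R]_n) :
  (forall i j, M x i j @[x --> F] --> A i j) -> \det (M x) @[x --> F] --> \det A.
Proof.
move=> MA; apply: cvg_big => [|s _]; first exact: add_continuous.
apply: cvgM; first exact: cvg_cst.
by apply: cvg_big => [|i _]; [exact: mul_continuous|exact: MA].
Qed.

Section continuity.
Context {R : realType}.
Variables p0 q0 : R.
Hypotheses (p0_gt0 : 0 < p0) (q0_gt1 : 1 < q0).

Local Notation near_pq := (nbhs (p0, q0)).

Let cvg_p : pq.1 @[pq --> (p0, q0)] --> p0.
Proof. exact: cvg_fst. Qed.

Let cvg_q : pq.2 @[pq --> (p0, q0)] --> q0.
Proof. exact: cvg_snd. Qed.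

Let near_pos : \forall pq \near (p0, q0), 0 < pq.1 /\ 1 <= pq.2.
Proof.
near=> pq; split; first by near: pq; exact: (cvgr_gt _ cvg_p).
by apply/ltW; near: pq; exact: (cvgr_gt _ cvg_q).
Unshelve. all: by end_near. Qed.

(** Induction along the rational recursion of the moments, which holds at all nearby parameters
    because [1 < q0] is strict. *)
Lemma cvg_moment_betar n :
  moment (betar pq.1 pq.2) n @[pq --> (p0, q0)] --> moment (betar p0 q0) n.
Proof.
elim: n => [|n IH].
  apply: (@cvg_trans _ (cst (1 : R) @ near_pq)).
    apply: near_eq_cvg; apply: (@filterS _ near_pq (nbhs_filter _) _ _ _ near_pos) => pq [h1 h2].
    by rewrite moment_betar0.
  by rewrite moment_betar0// ?ltW//; exact: cvg_cst.
pose f (pq : R * R) := (pq.1 + n%:R) / (pq.1 + pq.2 + n%:R) * moment (betar pq.1 pq.2) n.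
apply: (@cvg_trans _ (f @ near_pq)).
  apply: near_eq_cvg; apply: (@filterS _ near_pq (nbhs_filter _) _ _ _ near_pos) => pq [h1 h2].
  by rewrite /f moment_betarS.
rewrite moment_betarS ?ltW//; apply: cvgM; last exact: IH.
apply: cvgM.
  exact: (cvgD cvg_p (cvg_cst _)).
apply: cvgV.
  by rewrite gt_eqF// ltr_wpDr// addr_gt0// (lt_trans ltr01).
exact: (cvgD (cvgD cvg_p cvg_q) (cvg_cst _)).
Qed.

(** A free cumulant is the moment minus a polynomial in cumulants of smaller index, so strong
    induction applies. *)
Lemma cvg_free_cumulant n : (0 < n)%N ->
  free_cumulant (betar pq.1 pq.2) n @[pq --> (p0, q0)] -->
  free_cumulant (betar p0 q0) n.
Proof.
elim/ltn_ind: n => n IH n0.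
have kE (p q : R) : free_cumulant (betar p q) n = moment (betar p q) n -
    \sum_(P in NC n | P != [set [set: 'I_n]]%SET)
      \prod_(V in P) free_cumulant (betar p q) #|V|.
  have := free_cumulantP (betar p q) n0; rewrite moment_cumulantE// => ->.
  by rewrite addrK.
pose f (pq : R * R) := moment (betar pq.1 pq.2) n -
  \sum_(P in NC n | P != [set [set: 'I_n]]%SET)
      \prod_(V in P) free_cumulant (betar pq.1 pq.2) #|V|.
apply: (@cvg_trans _ (f @ near_pq)).
  by apply: near_eq_cvg; apply: nearW => pq; rewrite /f -kE.
rewrite kE; apply: cvgB; first exact: cvg_moment_betar.
apply: cvg_big => [|P /andP[PNC PT]]; first exact: add_continuous.
apply: cvg_big => [|V VP]; first exact: mul_continuous.
have V_gt0 : (0 < #|V|)%N.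
  rewrite card_gt0; apply: contraTneq VP => ->.
  by move: PNC; rewrite finset.inE => /andP[/and3P[]].
have H := IH #|V| (NC_card_lt PNC PT VP) V_gt0; exact H.
Qed.

Lemma cvg_hankel_det n :
  hankel_det (betar pq.1 pq.2) n @[pq --> (p0, q0)] --> hankel_det (betar p0 q0) n.
Proof.
apply: cvg_det => i j.
have hE (mu : {measure set R -> \bar R}) :
  hankel mu n i j = free_cumulant mu (i + j + 2) by rewrite mxE.
pose f (pq : R * R) := free_cumulant (betar pq.1 pq.2) (i + j + 2).
have n_gt0 : (0 < i + j + 2)%N by rewrite addn2.
have H := cvg_free_cumulant n_gt0.
apply: (@cvg_trans _ (f @ near_pq)).
  by apply: near_eq_cvg; apply: nearW => pq; rewrite hE.
rewrite hE; exact H.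
Qed.

End continuity.

(** * Hankel tests from the signs of determinants *)

Section hankel.
Context {R : realType}.
Implicit Types mu : {measure set R -> \bar R}.

Definition hankel_fun mu (i j : nat) : R := free_cumulant mu (i + j).+2.

Lemma hankel_lead mu N : hankel mu N = lead (hankel_fun mu) N.
Proof. by apply/matrixP => i j; rewrite !mxE addn2. Qed.

Lemma hankel_fun_sym mu i j : hankel_fun mu i j = hankel_fun mu j i.
Proof. by rewrite /hankel_fun addnC. Qed.

Lemma hankel_test_pos mu n :
  (forall j, (j <= n)%N -> 0 < hankel_det mu j) -> hankel_test mu n.
Proof.
move=> h; rewrite /hankel_test hankel_lead.
apply/possemidef_lead; first exact: hankel_fun_sym.
apply: psd_det_gt0 => [|j /h]; first exact: hankel_fun_sym.
by rewrite /hankel_det hankel_lead.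
Qed.

Lemma hankel_test_neg mu n : (forall j, (j < n)%N -> 0 < hankel_det mu j) ->
  hankel_det mu n < 0 -> ~ hankel_test mu n.
Proof.
move=> h hn; rewrite /hankel_test hankel_lead.
move=> /(possemidef_lead _ (hankel_fun_sym mu)); apply: not_psd_det_lt0.
- exact: hankel_fun_sym.
- by move=> j /h; rewrite /hankel_det hankel_lead.
- by rewrite -hankel_lead.
Qed.

End hankel.

(** * Numerical certificate at [p = 7/10] *)

Lemma zr_of_nat (R : realFieldType) n : zr R (Z.of_nat n) = n%:R.
Proof. by rewrite /zr (_ : int_of_Z _ = n%:Z)//; lia. Qed.

(** These are [10 * (7 / 10 + qval N)]: multiplying by 10 makes the ratios of consecutive moments
    quotients of integers, with numerators [7 + 10 n]. *)
Definition denominator (N : nat) : nat :=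
  nth 0%N [:: 27; 32; 37; 47; 57; 77; 107; 127; 157; 207] (N - 2).

(* The precision follows the decay of the pivots, which lose a few bits at each
   step of the elimination. *)
Definition check_qval (N : nat) : bool :=
  check (Z.of_nat (12 * N + 12)) 7 (Z.of_nat (denominator N)) N.

Lemma check_qvalT : all check_qval (iota 2 10).
Proof. by vm_cast_no_check (erefl true). Qed.

Lemma qval_denominator (R : realType) N : (2 <= N <= 11)%N ->
  (denominator N)%:R = 10 * (7 / 10 + qval N) :> R.
Proof.
by case: N => [|[|N]]//; rewrite /denominator /qval !subSS subn0;
   do 10![case: N => [_|N]; first by rewrite /=; lra].
Qed.

Lemma qval_ge2 (R : realType) N : (2 <= N <= 11)%N -> 2 <= qval N :> R.
Proof.
by case: N => [|[|N]]//; rewrite /qval !subSS subn0;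
   do 10![case: N => [_|N]; first by rewrite /=; lra].
Qed.

Lemma hankel_signs (R : realType) N : (2 <= N <= 11)%N ->
  pivot_signs (hankel_fun (betar (7 / 10 : R) (qval N))) N.
Proof.
move=> hN; set q := qval N; set mu := betar _ _.
have p0 : 0 < 7 / 10 :> R by lra.
have q2 : 2 <= q := qval_ge2 R hN.
have q1 : 1 <= q by lra.
have [g [g0 gS gm]] :=
  moment_cumulant_triangle (free_cumulantP mu) (moment_betar0 p0 q1).
have dE := qval_denominator R hN; rewrite -/q in dE.
have hc : check_qval N.
  by have /allP/(_ N) := check_qvalT; apply; rewrite mem_iota.
set d := Z.of_nat (denominator N) in hc.
have d0 : Z.lt 0 d.
  have : 0 < (denominator N)%:R :> R by rewrite dE; lra.
  by rewrite ltr0n /d; lia.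
have mS t : moment mu t.+1 = zr R (Z.add 7 (Z.mul 10 (Z.of_nat t))) /
    zr R (Z.add d (Z.mul 10 (Z.of_nat t))) * moment mu t.
  rewrite moment_betarS// !zrD !zrM !zr_of_nat dE; congr (_ * _).
  have -> : zr R 7 = 7 by [].
  have -> : zr R 10 = 10 by [].
  by field; have := ler0n R t; lra.
have k0 : Z.le 0 (Z.of_nat (12 * N + 12)) by lia.
have := checkP k0 (erefl : Z.lt 0 7) d0 (moment_betar0 p0 q1) mS gS gm hc.
by congr (pivot_signs _ _); apply/funext => i; apply/funext => j; rewrite g0.
Qed.

(** In the first family, [n = 1] gives []1/2, 2/3[] and the other intervals lie in []3/4, 1[]; the
    second family lies in []1, 3/2[]. The gap []2/3, 3/4[] contains 7/10. *)
Lemma Iset_bounds (R : realType) (x : R) : Iset x ->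
  x < 2 / 3 \/ 3 / 4 < x < 3 / 2.
Proof.
case=> -[[|n]//= _]; rewrite in_itv/= => /andP[];
    set t : R := n.+1%:R; move=> xl xr.
  have t1 : 1 <= t by rewrite ler1n.
  have [n0|n0] := leqP n 0.
    have te : t = 1 by move: n0; rewrite leqn0 /t => /eqP ->.
    by left; move: xr; rewrite te ltr_pdivlMr; lra.
  have t2 : 2 <= t by rewrite /t ler_nat ltnS.
  right; rewrite (le_lt_trans _ xl) ?(lt_trans xr)//.
    by rewrite ltr_pdivrMr; lra.
  by rewrite ler_pdivlMr; lra.
have t1 : 1 <= t by rewrite ler1n.
right; rewrite (lt_trans _ xl) ?(lt_le_trans xr)//.
  by rewrite ler_pdivrMr; lra.
by rewrite ltr_pdivlMr; lra.
Qed.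

Theorem theorem5p1 (R : realType) :
  (forall N : nat, (2 <= N <= 11)%N ->
     (forall j : nat, (j <= N - 1)%N ->
        0 < hankel_det (betar (7 / 10 : R) (qval N)) j) /\
     hankel_det (betar (7 / 10 : R) (qval N)) N < 0) /\
  (forall N : nat, (2 <= N <= 11)%N ->
     exists U : set (R * R),
       [/\ open U, U !=set0,
           U `<=` [set pq : R * R | 0 < pq.1 /\ 0 < pq.2] &
           forall p q : R, U (p, q) ->
             [/\ ~ hankel_test (betar p q) N,
                 forall j : nat, (j <= N - 1)%N -> hankel_test (betar p q) j,
                 ~ Iset p, ~ Iset q &
                 ~ (`]0, 1]%classic `*` `]0, 1]%classic) (p, q)]]).
Proof.
have signs N : (2 <= N <= 11)%N ->
    (forall j : nat, (j < N)%N -> 0 < hankel_det (betar (7 / 10 : R) (qval N)) j) /\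
    hankel_det (betar (7 / 10 : R) (qval N)) N < 0.
  move=> hN; have [h1 h2] := det_pivot_signs (hankel_signs R hN).
  by split => [j|]; rewrite /hankel_det hankel_lead; [exact: h1|exact: h2].
have lt_N N j : (2 <= N <= 11)%N -> (j <= N - 1)%N = (j < N)%N by lia.
split=> N hN; have [pos neg] := signs N hN.
  by split=> // j; rewrite lt_N//; exact: pos.
have q2 := qval_ge2 R hN; set q0 := qval N in pos neg q2.
(* The bounds on [pq.1] and [pq.2] keep both parameters out of [Iset], and [pq.2 > 3 / 2] also
   excludes the unit square. *)
pose U := [set pq : R * R | [/\ 2 / 3 < pq.1 < 3 / 4, 3 / 2 < pq.2,
  forall j : 'I_N, 0 < hankel_det (betar pq.1 pq.2) j &
  hankel_det (betar pq.1 pq.2) N < 0]].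
have p0_gt0 : 0 < 7 / 10 :> R by lra.
have q0_gt1 : 1 < q0 by lra.
have Unbhs : nbhs (7 / 10 : R, q0) U.
  have cp : pq.1 @[pq --> (7 / 10 : R, q0)] --> (7 / 10 : R) by exact: cvg_fst.
  have cq : pq.2 @[pq --> (7 / 10 : R, q0)] --> q0 by exact: cvg_snd.
  have FF := nbhs_filter (7 / 10 : R, q0).
  have c j := @cvg_hankel_det R _ _ p0_gt0 q0_gt1 j.
  have e1 : \forall pq \near (7 / 10 : R, q0), 2 / 3 < pq.1.
    by apply: (cvgr_gt _ cp); lra.
  have e2 : \forall pq \near (7 / 10 : R, q0), pq.1 < 3 / 4.
    by apply: (cvgr_lt _ cp); lra.
  have e3 : \forall pq \near (7 / 10 : R, q0), 3 / 2 < pq.2.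
    by apply: (cvgr_gt _ cq); lra.
  have e4 : \forall pq \near (7 / 10 : R, q0),
      forall j : 'I_N, 0 < hankel_det (betar pq.1 pq.2) j.
    apply: (@filter_forall _ _ (fun (j : 'I_N) (pq : R * R) =>
      0 < hankel_det (betar pq.1 pq.2) j) _ FF) => j.
    have H := cvgr_gt _ (c j) 0 (pos _ (ltn_ord j)); exact (H FF).
  have e5 : \forall pq \near (7 / 10 : R, q0), hankel_det (betar pq.1 pq.2) N < 0.
    have H := cvgr_lt _ (c N) 0 neg; exact (H FF).
  have e := @filterI _ _ FF _ _ e1 (@filterI _ _ FF _ _ e2
    (@filterI _ _ FF _ _ e3 (@filterI _ _ FF _ _ e4 e5))).
  apply: (@filterS _ _ FF _ _ _ e) => pq [h1 [h2 [h3 [h4 h5]]]].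
  by split => //; rewrite h1 h2.
(* [U] is only shown to be a neighborhood of the base point, so its interior serves as the open
   set. *)
exists (interior U); split.
- exact: open_interior.
- by exists (7 / 10, q0); exact: Unbhs.
- by move=> [p q] /interior_subset[/= /andP[h1 _] h2 _ _]; split; lra.
move=> p q /interior_subset[/= /andP[p1 p2] q1 pos' neg'].
have pos'' j : (j < N)%N -> 0 < hankel_det (betar p q) j.
  by move=> jN; exact: (pos' (Ordinal jN)).
split.
- exact: hankel_test_neg.
- move=> j; rewrite lt_N// => jN; apply: hankel_test_pos => i ij.
  exact/pos''/(leq_ltn_trans ij).
- by clear -p1 p2; move=> /Iset_bounds[|/andP[]]; lra.
- by clear -q1; move=> /Iset_bounds[|/andP[]]; lra.
- by clear -q1; move=> [_ /=]; rewrite in_itv/= => /andP[_]; lra.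
Qed.
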